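(* Let $-\pi/2<\alpha<\pi/2$ and $\lambda<1$. For every $f\in\mathcal{S}^*_\alpha(\lambda)$, $\|J[f]\|\le 4(1-\lambda)\cos\alpha$, and this inequality is sharp: equality holds for some $f\in\mathcal{S}^*_\alpha(\lambda)$.
   Context: $\mathbb{D}$ is the open unit disk; $\mathcal{A}$ the class of analytic $f$ on $\mathbb{D}$ with $f(0)=0$, $f'(0)=1$. For $\alpha\in(-\pi/2,\pi/2)$, $\lambda<1$, $\mathcal{S}^*_\alpha(\lambda)=\{f\in\mathcal{A}: f(z)\neq0 \text{ for } z\ne 0,\ \mathrm{Re}\,(e^{i\alpha}zf'(z)/f(z))>\lambda\cos\alpha \text{ on }\mathbb{D}\}$. The Alexander transform is $J[f](z)=\int_0^z f(w)/w\,dw$. For $h\in\mathcal{A}$ with $h'$ nonvanishing on $\mathbb{D}$, the pre-Schwarzian norm is $\|h\|=\sup_{z\in\mathbb{D}}(1-|z|^2)|h''(z)/h'(z)|$. *)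

(* Defs.v *)
From Stdlib Require Import Reals ClassicalEpsilon.
From Coquelicot Require Export Coquelicot.
Open Scope R_scope.

Definition in_disk (z : C) : Prop := Cmod z < 1.

(* complex derivative (a chosen value; meaningful where f is complex-differentiable) *)
Definition Cderiv (f : C -> C) (z : C) : C :=
  epsilon (inhabits (RtoC 0)) (fun l : C => is_derive (K := C_AbsRing) (V := C_NormedModule) f z l).

Definition analytic_on_disk (f : C -> C) : Prop :=
  forall z : C, in_disk z -> ex_derive (K := C_AbsRing) (V := C_NormedModule) f z.

Definition classA (f : C -> C) : Prop :=
  analytic_on_disk f /\ f (RtoC 0) = RtoC 0 /\ Cderiv f (RtoC 0) = RtoC 1.

Definition cexpi (a : R) : C := (cos a, sin a).

(* S*_alpha(lambda); the quantity z f'(z)/f(z) is taken at z <> 0 (at z = 0 it is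
   the removable value 1, for which the inequality cos a > lam cos a holds anyway) *)
Definition Sstar (alpha lam : R) (f : C -> C) : Prop :=
  classA f /\
  (forall z : C, in_disk z -> z <> RtoC 0 -> f z <> RtoC 0) /\
  (forall z : C, in_disk z -> z <> RtoC 0 ->
     Re (Cmult (cexpi alpha) (Cdiv (Cmult z (Cderiv f z)) (f z))) > lam * cos alpha).

(* Alexander transform J[f](z) = int_0^z f(w)/w dw, along the segment w = t z, t in [0,1] *)
Definition alexander (f : C -> C) (z : C) : C :=
  RInt (V := C_R_CompleteNormedModule)
       (fun t : R => Cmult (Cdiv (f (Cmult (RtoC t) z)) (Cmult (RtoC t) z)) z) 0 1.

Definition preschwarzian_norm (h : C -> C) : Rbar :=
  Lub_Rbar (fun r : R => exists z : C, in_disk z /\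
     r = (1 - Cmod z ^ 2) * Cmod (Cdiv (Cderiv (Cderiv h) z) (Cderiv h z))).

(* Main.v *)
Require Import Defs.
From Stdlib Require Import Reals Lra Lia ClassicalEpsilon.
From Coquelicot Require Import Coquelicot.
Open Scope R_scope.

(** Write [f z = z * g z]. Then [J[f]' = g], so the pre-Schwarzian derivative of [J[f]] is
    [q = g' / g], and [z f' / f = 1 + z q]. With [B = (1 - lam) cos alpha] and
    [s = e^(i alpha) q / B], the spirallikeness condition reads [Re (1 + z s) > 0]; Schwarz's
    lemma applied to [z s / (2 + z s)] gives [|s z| <= 2 / (1 - |z|)], hence
    [(1 - |z|^2) |q z| <= 2 B (1 + |z|) <= 4 B]. Equality is approached along [z -> 1] for
    [g = (1 - z)^(- 2 B e^(- i alpha))], for which [s = 2 / (1 - z)].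

    Holomorphy is only assumed as pointwise complex differentiability, so Cauchy's theory on
    the disk is needed: Goursat's theorem yields a primitive [F] of a holomorphic [f]; since
    [F'] is continuous, [F] satisfies Cauchy's formula (the integral of
    [F (a + t (zeta - a)) zeta / (zeta - a)] over the circle does not depend on [t]), and
    differentiating under the integral shows that [f' = F''] is holomorphic again. *)

(** * Complex derivatives and integrals along real intervals *)

(** Origin of the normalisation: e^(i alpha) z f'/f = e^(i alpha) + B z s, and since cos alpha - lam
    cos alpha = B, its real part exceeds lam cos alpha exactly when Re (z s) > -1. The quotient z s
    / (2 + z s) is the Cayley transform of 1 + z s. Equality in Schwarz's lemma makes it a
    unimodular multiple of z; the multiple 1 gives s = 2 / (1 - z), and integrating g'/g = B e^(- i
    alpha) s produces the extremal function. Two facts about holomorphic functions cannot be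
    avoided: q contains g', so derivatives must be holomorphic, and g = f / z must extend across 0.
    Both follow from Cauchy's formula, but its proof by homotopy needs a continuous derivative,
    which pointwise differentiability does not provide at once. The primitive F is used because its
    derivative f is continuous for free. *)

Notation CU := (AbsRing_UniformSpace C_AbsRing).
Notation CV := (AbsRing_NormedModule C_AbsRing).
Notation hder := (is_derive (K := C_AbsRing) (V := CV)).
Notation rder := (is_derive (K := R_AbsRing) (V := C_R_NormedModule)).
Notation ccont u x := (@continuous _ CU u x).

Lemma Cmod_minus_sym (a b : C) : Cmod (a - b)%C = Cmod (b - a)%C.
Proof. rewrite <- Cmod_opp. f_equal. ring. Qed.

Lemma Cmod_R_norm (z : C) : @norm _ C_R_NormedModule z = Cmod z.
Proof. symmetry; apply Cmod_norm. Qed.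

(** Turns the filter definition of the derivative into an estimate in the modulus, the form in which
    all remainders below are computed. *)
Lemma hder_iff (f : C -> C) (z l : C) :
  hder f z l <->
  forall eps : R, 0 < eps -> exists d : R, 0 < d /\
    forall w : C, Cmod (w - z)%C < d ->
      Cmod (f w - f z - (w - z) * l)%C <= eps * Cmod (w - z)%C.
Proof.
  split.
  - intros [_ H] eps He.
    destruct (H z (fun P HP => HP) (mkposreal eps He)) as [d Hd].
    exists d; split; [apply cond_pos|].
    intros w Hw. exact (Hd w Hw).
  - intros H; split; [apply is_linear_scal_l|].
    intros x Hx.
    rewrite <- (is_filter_lim_locally_unique (V := CV) z x Hx).
    intros eps. destruct (H eps (cond_pos eps)) as [d [Hd0 Hd]].
    exists (mkposreal d Hd0). intros w Hw. exact (Hd w Hw).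
Qed.

(** Bridge between the module structure used in [Cderiv] and [analytic_on_disk] and the one used
    here: both have the modulus as norm, so both give the same estimate. *)
Lemma is_derive_C_hder (f : C -> C) (z l : C) :
  is_derive (K := C_AbsRing) (V := C_NormedModule) f z l <-> hder f z l.
Proof.
  rewrite hder_iff. split.
  - intros [_ H] eps He.
    destruct (H z (fun P HP => HP) (mkposreal eps He)) as [d Hd].
    exists d; split; [apply cond_pos|].
    intros w Hw. exact (Hd w Hw).
  - intros H; split; [apply is_linear_scal_l|].
    intros x Hx.
    rewrite <- (is_filter_lim_locally_unique (V := CV) z x Hx).
    intros eps. destruct (H eps (cond_pos eps)) as [d [Hd0 Hd]].
    exists (mkposreal d Hd0). intros w Hw. exact (Hd w Hw).
Qed.

Lemma rder_iff (f : R -> C) (z : R) (l : C) :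
  rder f z l <->
  forall eps : R, 0 < eps -> exists d : R, 0 < d /\
    forall w : R, Rabs (w - z) < d ->
      Cmod (f w - f z - RtoC (w - z) * l)%C <= eps * Rabs (w - z).
Proof.
  split.
  - intros [_ H] eps He.
    destruct (H z (fun P HP => HP) (mkposreal eps He)) as [d Hd].
    exists d; split; [apply cond_pos|].
    intros w Hw. specialize (Hd w Hw). rewrite <- scal_R_Cmult, Cmod_norm. exact Hd.
  - intros H; split; [apply is_linear_scal_l|].
    intros x Hx.
    rewrite <- (is_filter_lim_locally_unique (V := R_NormedModule) z x Hx).
    intros eps. destruct (H eps (cond_pos eps)) as [d [Hd0 Hd]].
    exists (mkposreal d Hd0). intros w Hw. specialize (Hd w Hw).
    rewrite <- scal_R_Cmult, Cmod_norm in Hd. exact Hd.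
Qed.

Lemma ccont_iff (T : UniformSpace) (f : T -> C) (z : T) :
  ccont f z <->
  forall eps : R, 0 < eps -> locally z (fun w => Cmod (f w - f z)%C < eps).
Proof.
  split.
  - intros H eps He.
    apply (H (fun y : C => Cmod (y - f z)%C < eps)).
    exists (mkposreal eps He). intros y Hy. exact Hy.
  - intros H P [eps HP].
    unfold filtermap. generalize (H eps (cond_pos eps)). apply filter_imp.
    intros w Hw. apply HP. exact Hw.
Qed.

Lemma ccont_C (f : C -> C) (z : C) :
  @continuous CU CU f z <->
  forall eps : R, 0 < eps -> exists d : R, 0 < d /\
    forall w : C, Cmod (w - z)%C < d -> Cmod (f w - f z)%C < eps.
Proof.
  rewrite (ccont_iff CU). split.
  - intros H eps He. destruct (H eps He) as [d Hd].
    exists d; split; [apply cond_pos|]. exact Hd.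
  - intros H eps He. destruct (H eps He) as [d [Hd0 Hd]].
    exists (mkposreal d Hd0). exact Hd.
Qed.

Lemma ccont_R (f : R -> C) (z : R) :
  @continuous R_UniformSpace CU f z <->
  forall eps : R, 0 < eps -> exists d : R, 0 < d /\
    forall w : R, Rabs (w - z) < d -> Cmod (f w - f z)%C < eps.
Proof.
  rewrite (ccont_iff R_UniformSpace). split.
  - intros H eps He. destruct (H eps He) as [d Hd].
    exists d; split; [apply cond_pos|]. exact Hd.
  - intros H eps He. destruct (H eps He) as [d [Hd0 Hd]].
    exists (mkposreal d Hd0). exact Hd.
Qed.

(** Integrals live in [C_R_NormedModule], with its product topology, while continuity is handled
    with the modulus; the two have the same neighbourhoods. *)
Lemma ccont_C_R (T : UniformSpace) (f : T -> C) (z : T) :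
  ccont f z -> @continuous T C_R_NormedModule f z.
Proof.
  intros H P HP. apply (H P). apply locally_C. exact HP.
Qed.

Lemma hder_ccont (f : C -> C) (z l : C) : hder f z l -> @continuous CU CU f z.
Proof.
  intros H. apply (ex_derive_continuous (K := C_AbsRing) (V := CV)).
  now exists l.
Qed.

Lemma C_AbsRing_mult_comm (n m : C_AbsRing) : mult n m = mult m n.
Proof. apply Cmult_comm. Qed.

Lemma hder_eq (f : C -> C) (z l l' : C) : hder f z l -> l = l' -> hder f z l'.
Proof. now intros H <-. Qed.

Lemma hder_mult (f g : C -> C) (z a b : C) :
  hder f z a -> hder g z b -> hder (fun w => f w * g w)%C z (a * g z + f z * b)%C.
Proof. intros Hf Hg. exact (is_derive_mult f g z a b Hf Hg C_AbsRing_mult_comm). Qed.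

Lemma hder_plus (f g : C -> C) (z a b : C) :
  hder f z a -> hder g z b -> hder (fun w => f w + g w)%C z (a + b)%C.
Proof. intros Hf Hg. exact (is_derive_plus (V := CV) f g z a b Hf Hg). Qed.

Lemma hder_minus (f g : C -> C) (z a b : C) :
  hder f z a -> hder g z b -> hder (fun w => f w - g w)%C z (a - b)%C.
Proof. intros Hf Hg. exact (is_derive_minus (V := CV) f g z a b Hf Hg). Qed.

Lemma hder_const (c z : C) : hder (fun _ => c) z (RtoC 0).
Proof. exact (is_derive_const (V := CV) c z). Qed.

Lemma hder_id (z : C) : hder (fun w => w) z (RtoC 1).
Proof. exact (is_derive_id z). Qed.

Lemma hder_comp (f g : C -> C) (z a b : C) :
  hder f (g z) a -> hder g z b -> hder (fun w => f (g w)) z (a * b)%C.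
Proof.
  intros Hf Hg. rewrite Cmult_comm.
  exact (is_derive_comp (V := CV) f g z a b Hf Hg).
Qed.

Lemma Cmod_reverse (a b : C) : Cmod a - Cmod b <= Cmod (a - b)%C.
Proof.
  replace a with ((a - b) + b)%C at 1 by ring.
  generalize (Cmod_triangle (a - b)%C b). lra.
Qed.

Lemma hder_inv_id (z : C) : z <> RtoC 0 -> hder Cinv z (- (/ z * / z))%C.
Proof.
  intros Hz. apply hder_iff. intros eps He.
  assert (Hm : 0 < Cmod z) by now apply Cmod_gt_0.
  set (m := Cmod z) in *.
  (* The remainder is (w - z)^2 / (w z^2). The first bound keeps |w| > m/2, so the denominator
     exceeds m^3/2; the second then leaves at most eps |w - z|. *)
  exists (Rmin (m / 2) (eps * m ^ 3 / 2)).
  assert (0 < eps * m ^ 3 / 2) by (apply Rdiv_lt_0_compat; [|lra]; apply Rmult_lt_0_compat; [lra|]; apply pow_lt; lra).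
  split. apply Rmin_pos; lra.
  intros w Hw.
  assert (H1 := Rlt_le_trans _ _ _ Hw (Rmin_l _ _)).
  assert (H2 := Rlt_le_trans _ _ _ Hw (Rmin_r _ _)).
  assert (Hwm : m / 2 < Cmod w).
  { generalize (Cmod_reverse z w). rewrite Cmod_minus_sym. fold m. lra. }
  assert (Hw0 : w <> RtoC 0) by (apply Cmod_gt_0; lra).
  replace (/ w - / z - (w - z) * - (/ z * / z))%C
    with ((w - z) * (w - z) / (w * z * z))%C by (field; auto).
  assert (w * z * z <> 0)%C by (repeat apply Cmult_neq_0; auto).
  rewrite Cmod_div by auto. rewrite !Cmod_mult. fold m.
  set (e := Cmod (w - z)%C) in *. assert (0 <= e) by apply Cmod_ge_0.
  assert (0 < Cmod w * m * m) by (repeat apply Rmult_lt_0_compat; lra).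
  apply Rmult_le_reg_r with (Cmod w * m * m); auto.
  replace (e * e / (Cmod w * m * m) * (Cmod w * m * m)) with (e * e) by (field; lra).
  assert (m ^ 3 / 2 <= Cmod w * m * m) by (simpl; nra).
  assert (eps * (m ^ 3 / 2) <= eps * (Cmod w * m * m)) by (apply Rmult_le_compat_l; lra).
  nra.
Qed.

Lemma hder_inv (f : C -> C) (z a : C) :
  hder f z a -> f z <> RtoC 0 -> hder (fun w => / f w)%C z (- a / (f z * f z))%C.
Proof.
  intros Hf Hz. eapply hder_eq.
  apply (hder_comp Cinv f); [now apply hder_inv_id | exact Hf].
  field; auto.
Qed.

Lemma ccont_inv_id (z : C) : z <> RtoC 0 -> @continuous CU CU Cinv z.
Proof. intros H. eapply hder_ccont. now apply hder_inv_id. Qed.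

Lemma ccont_inv (T : UniformSpace) (f : T -> C) (x : T) :
  ccont f x -> f x <> RtoC 0 -> ccont (fun t => / f t)%C x.
Proof.
  intros Hf Hx. apply (@continuous_comp T CU CU f Cinv); auto. now apply ccont_inv_id.
Qed.

Lemma ccont_plus (T : UniformSpace) (f g : T -> C) (x : T) :
  ccont f x -> ccont g x -> ccont (fun t => f t + g t)%C x.
Proof. intros Hf Hg. exact (continuous_plus (V := CV) f g x Hf Hg). Qed.

Lemma ccont_minus (T : UniformSpace) (f g : T -> C) (x : T) :
  ccont f x -> ccont g x -> ccont (fun t => f t - g t)%C x.
Proof. intros Hf Hg. exact (continuous_minus (V := CV) f g x Hf Hg). Qed.

Lemma ccont_mult (T : UniformSpace) (f g : T -> C) (x : T) :
  ccont f x -> ccont g x -> ccont (fun t => f t * g t)%C x.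
Proof. intros Hf Hg. exact (continuous_mult (K := C_AbsRing) f g x Hf Hg). Qed.

Lemma ccont_const (T : UniformSpace) (c : C) (x : T) : ccont (fun _ : T => c) x.
Proof. apply continuous_const. Qed.

Lemma ccont_comp (T : UniformSpace) (f : C -> C) (g : T -> C) (x : T) :
  ccont g x -> @continuous CU CU f (g x) -> ccont (fun t => f (g t)) x.
Proof. intros Hg Hf. now apply (@continuous_comp T CU CU g f). Qed.

Lemma ccont_RtoC (T : UniformSpace) (f : T -> R) (x : T) :
  continuous f x -> ccont (fun t => RtoC (f t)) x.
Proof.
  intros Hf. apply ccont_iff. intros eps He.
  assert (H := proj1 (filterlim_locally f (f x)) Hf (mkposreal eps He)).
  revert H. apply filter_imp. intros w Hw.
  rewrite <- RtoC_minus, Cmod_R. exact Hw.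
Qed.

Lemma rder_ccont (f : R -> C) (t : R) (l : C) : rder f t l -> @continuous R_UniformSpace CU f t.
Proof.
  intros H. intros P HP. apply locally_C in HP.
  assert (H1 : @continuous R_UniformSpace C_R_NormedModule f t).
  { apply (ex_derive_continuous (K := R_AbsRing) (V := C_R_NormedModule)). now exists l. }
  apply H1. exact HP.
Qed.

(** Chain rule with mixed scalars: a complex derivative outside, a curve inside. The error is the
    remainder of [F] at the increment [G], plus [l] times the remainder of [g]. *)
Lemma hder_rder_comp (F : C -> C) (g : R -> C) (t : R) (l d : C) :
  hder F (g t) l -> rder g t d -> rder (fun s => F (g s)) t (l * d)%C.
Proof.
  intros HF Hg.
  assert (Hc := proj1 (ccont_R g t) (rder_ccont _ _ _ Hg)).
  rewrite hder_iff in HF. rewrite rder_iff in Hg. rewrite rder_iff.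
  intros eps He.
  (* For e <= 1 the two errors add up to at most e A |w - t|. *)
  set (A := Cmod d + 1 + Cmod l).
  assert (0 <= Cmod d) by apply Cmod_ge_0. assert (0 <= Cmod l) by apply Cmod_ge_0.
  assert (HA : 0 < A) by (unfold A; lra).
  set (e := Rmin 1 (eps / A)).
  assert (Hep : 0 < eps / A) by now apply Rdiv_lt_0_compat.
  assert (He0 : 0 < e) by (apply Rmin_pos; lra).
  assert (He1 : e <= 1) by apply Rmin_l.
  assert (He2 : e * A <= eps).
  { apply Rle_trans with (eps / A * A). apply Rmult_le_compat_r; [lra|apply Rmin_r].
    right; field; lra. }
  destruct (HF e He0) as [d1 [Hd1 H1]].
  destruct (Hg e He0) as [d2 [Hd2 H2]].
  destruct (Hc d1 Hd1) as [d3 [Hd3 H3]].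
  exists (Rmin d2 d3). split; [now apply Rmin_pos|].
  intros w Hw.
  assert (W2 := H2 w (Rlt_le_trans _ _ _ Hw (Rmin_l _ _))).
  assert (W1 := H1 _ (H3 w (Rlt_le_trans _ _ _ Hw (Rmin_r _ _)))).
  set (r := (w - t)) in *.
  set (G := (g w - g t)%C) in *.
  replace (F (g w) - F (g t) - r * (l * d))%C
    with ((F (g w) - F (g t) - G * l) + (G - r * d) * l)%C by ring.
  eapply Rle_trans; [apply Cmod_triangle|].
  rewrite Cmod_mult.
  assert (HG : Cmod G <= e * Rabs r + Rabs r * Cmod d).
  { replace G with ((G - r * d) + r * d)%C by ring.
    eapply Rle_trans; [apply Cmod_triangle|]. rewrite Cmod_mult, Cmod_R. lra. }
  assert (0 <= Rabs r) by apply Rabs_pos.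
  apply Rle_trans with (e * A * Rabs r); [|apply Rmult_le_compat_r; lra].
  apply Rle_trans with (e * (e * Rabs r + Rabs r * Cmod d) + e * Rabs r * Cmod l).
  - apply Rplus_le_compat.
    + eapply Rle_trans; [apply W1|]. apply Rmult_le_compat_l; lra.
    + apply Rmult_le_compat_r; lra.
  - unfold A.
    assert (e * (e * Rabs r) <= e * (1 * Rabs r)).
    { apply Rmult_le_compat_l; [lra|]. apply Rmult_le_compat_r; lra. }
    nra.
Qed.

Notation cint := (RInt (V := C_R_CompleteNormedModule)).
Notation is_cint := (is_RInt (V := C_R_NormedModule)).

Lemma is_cint_unique (u : R -> C) (a b : R) (I : C) : is_cint u a b I -> cint u a b = I.
Proof. apply (is_RInt_unique (V := C_R_CompleteNormedModule)). Qed.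

Lemma cint_correct (u : R -> C) a b :
  (forall t, Rmin a b <= t <= Rmax a b -> @continuous R_UniformSpace CU u t) ->
  is_cint u a b (cint u a b).
Proof.
  intros H. apply (RInt_correct (V := C_R_CompleteNormedModule)).
  apply (ex_RInt_continuous (V := C_R_CompleteNormedModule)).
  intros t Ht. apply ccont_C_R. now apply H.
Qed.

Lemma is_cint_minus (u v : R -> C) (a b : R) (I J : C) :
  is_cint u a b I -> is_cint v a b J -> is_cint (fun t => u t - v t)%C a b (I - J)%C.
Proof. intros H1 H2. exact (is_RInt_minus (V := C_R_NormedModule) u v a b I J H1 H2). Qed.

Lemma is_cint_ext (u v : R -> C) (a b : R) (I : C) :
  (forall t, Rmin a b < t < Rmax a b -> u t = v t) -> is_cint u a b I -> is_cint v a b I.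
Proof. apply (is_RInt_ext (V := C_R_NormedModule)). Qed.

(** A complex factor is not a scalar of the real module in which the integral is taken, so the
    product is integrated component by component. *)
Lemma is_cint_scal (c : C) (u : R -> C) (a b : R) (I : C) :
  is_cint u a b I -> is_cint (fun t => c * u t)%C a b (c * I)%C.
Proof.
  intros H.
  assert (H1 := is_RInt_fct_extend_fst (U := R_NormedModule) (V := R_NormedModule) u a b I H).
  assert (H2 := is_RInt_fct_extend_snd (U := R_NormedModule) (V := R_NormedModule) u a b I H).
  apply (is_RInt_fct_extend_pair (U := R_NormedModule) (V := R_NormedModule)); simpl.
  - apply (is_RInt_minus (V := R_NormedModule) (fun t => fst c * fst (u t)) (fun t => snd c * snd (u t)));
    now apply (is_RInt_scal (V := R_NormedModule)).
  - apply (is_RInt_plus (V := R_NormedModule) (fun t => fst c * snd (u t)) (fun t => snd c * fst (u t)));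
    now apply (is_RInt_scal (V := R_NormedModule)).
Qed.

Lemma is_cint_bound (u : R -> C) (a b : R) (I : C) (M : R) : a <= b ->
  (forall t, a <= t <= b -> Cmod (u t) <= M) -> is_cint u a b I -> Cmod I <= (b - a) * M.
Proof.
  intros Hab H HI. rewrite Cmod_norm.
  apply (norm_RInt_le_const (V := C_R_NormedModule) u a b I M Hab); auto.
  intros x Hx. rewrite Cmod_R_norm. auto.
Qed.

Lemma is_cint_derive (u du : R -> C) a b :
  (forall t, Rmin a b <= t <= Rmax a b -> rder u t (du t)) ->
  (forall t, Rmin a b <= t <= Rmax a b -> @continuous R_UniformSpace CU du t) ->
  is_cint du a b (u b - u a)%C.
Proof.
  intros H1 H2. apply (is_RInt_derive (V := C_R_CompleteNormedModule) u du a b); auto.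
  intros t Ht. apply ccont_C_R. auto.
Qed.

(** * Goursat's theorem on the unit disk *)

Definition pt (a b : C) (t : R) : C := (a + RtoC t * (b - a))%C.

Definition seg (f : C -> C) (a b : C) : C := cint (fun t => f (pt a b t) * (b - a))%C 0 1.

Definition tri (f : C -> C) (a b c : C) : C := (seg f a b + seg f b c + seg f c a)%C.

Definition hol (f : C -> C) : Prop := forall z, in_disk z -> exists l : C, hder f z l.

Definition cont_disk (f : C -> C) : Prop := forall z, in_disk z -> @continuous CU CU f z.

Lemma hol_cont f : hol f -> cont_disk f.
Proof. intros H z Hz. destruct (H z Hz) as [l Hl]. eapply hder_ccont; eauto. Qed.

Lemma pt_convex (p a b : C) (r t : R) : 0 <= t <= 1 ->
  Cmod (a - p)%C <= r -> Cmod (b - p)%C <= r -> Cmod (pt a b t - p)%C <= r.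
Proof.
  intros Ht Ha Hb. unfold pt.
  replace (a + t * (b - a) - p)%C with (RtoC (1 - t) * (a - p) + RtoC t * (b - p))%C
    by (rewrite RtoC_minus; ring).
  eapply Rle_trans; [apply Cmod_triangle|].
  rewrite !Cmod_mult, !Cmod_R, !Rabs_pos_eq by lra. nra.
Qed.

Lemma pt_in_disk (a b : C) (t : R) : 0 <= t <= 1 ->
  in_disk a -> in_disk b -> in_disk (pt a b t).
Proof.
  unfold in_disk. intros Ht Ha Hb.
  assert (H := pt_convex (RtoC 0) a b (Rmax (Cmod a) (Cmod b)) t Ht).
  replace (a - 0)%C with a in H by ring. replace (b - 0)%C with b in H by ring.
  replace (pt a b t - 0)%C with (pt a b t) in H by ring.
  specialize (H (Rmax_l _ _) (Rmax_r _ _)).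
  eapply Rle_lt_trans; [apply H|]. now apply Rmax_lub_lt.
Qed.

Lemma rder_pt (a b : C) (t : R) : rder (pt a b) t (b - a)%C.
Proof.
  apply rder_iff. intros eps He. exists 1; split; [lra|]. intros w _.
  unfold pt. rewrite RtoC_minus.
  replace (_ - _)%C with (RtoC 0) by ring. rewrite Cmod_0.
  apply Rmult_le_pos; [lra|apply Rabs_pos].
Qed.

Lemma ccont_pt (a b : C) (t : R) : @continuous R_UniformSpace CU (pt a b) t.
Proof. eapply rder_ccont. apply rder_pt. Qed.

Lemma seg_integrand_cont (f : C -> C) (a b : C) :
  cont_disk f -> in_disk a -> in_disk b -> forall t, 0 <= t <= 1 ->
  @continuous R_UniformSpace CU (fun t => f (pt a b t) * (b - a))%C t.
Proof.
  intros Hf Ha Hb t Ht. apply (ccont_mult R_UniformSpace); [|apply ccont_const].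
  apply (ccont_comp R_UniformSpace f); [apply ccont_pt|].
  apply Hf. now apply pt_in_disk.
Qed.

Lemma is_seg (f : C -> C) (a b : C) :
  cont_disk f -> in_disk a -> in_disk b ->
  is_cint (fun t => f (pt a b t) * (b - a))%C 0 1 (seg f a b).
Proof.
  intros Hf Ha Hb. apply cint_correct. rewrite Rmin_left, Rmax_right by lra.
  now apply seg_integrand_cont.
Qed.

Lemma seg_bound (f : C -> C) (a b : C) (M : R) :
  cont_disk f -> in_disk a -> in_disk b ->
  (forall t, 0 <= t <= 1 -> Cmod (f (pt a b t)) <= M) ->
  Cmod (seg f a b) <= M * Cmod (b - a)%C.
Proof.
  intros Hf Ha Hb HM.
  replace (M * Cmod (b - a)%C) with ((1 - 0) * (M * Cmod (b - a)%C)) by ring.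
  eapply is_cint_bound; [lra| |now apply is_seg].
  intros t Ht. simpl. rewrite Cmod_mult.
  apply Rmult_le_compat_r; [apply Cmod_ge_0|auto].
Qed.

Lemma seg_primitive (F f : C -> C) (a b : C) :
  cont_disk f -> in_disk a -> in_disk b ->
  (forall t, 0 <= t <= 1 -> hder F (pt a b t) (f (pt a b t))) ->
  seg f a b = (F b - F a)%C.
Proof.
  intros Hf Ha Hb HF. apply is_cint_unique.
  replace (F b - F a)%C with (F (pt a b 1) - F (pt a b 0))%C
    by (unfold pt; f_equal; [|f_equal]; f_equal; ring).
  apply (is_cint_derive (fun t => F (pt a b t))); rewrite Rmin_left, Rmax_right by lra.
  - intros t Ht. apply hder_rder_comp; [now apply HF|apply rder_pt].
  - now apply seg_integrand_cont.
Qed.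

Lemma seg_minus (f g : C -> C) (a b : C) :
  cont_disk f -> cont_disk g -> in_disk a -> in_disk b ->
  seg (fun z => f z - g z)%C a b = (seg f a b - seg g a b)%C.
Proof.
  intros Hf Hg Ha Hb. apply is_cint_unique.
  apply is_cint_ext with (fun t => f (pt a b t) * (b - a) - g (pt a b t) * (b - a))%C.
  - intros t _. ring.
  - apply is_cint_minus; now apply is_seg.
Qed.

(** Substitution t -> 1 - t, written as the affine map -1 * t + 1. *)
Lemma seg_swap (f : C -> C) (a b : C) :
  cont_disk f -> in_disk a -> in_disk b -> seg f b a = (- seg f a b)%C.
Proof.
  intros Hf Ha Hb.
  replace (- seg f a b)%C with (cint (fun t => f (pt a b t) * (b - a))%C 1 0).
  2:{ rewrite <- (opp_RInt_swap (V := C_R_CompleteNormedModule)).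
      reflexivity. eexists; now apply is_seg. }
  apply is_cint_unique.
  assert (E : ex_RInt (V := C_R_CompleteNormedModule) (fun t => f (pt a b t) * (b - a))%C (-1 * 0 + 1) (-1 * 1 + 1)).
  { replace (-1 * 0 + 1) with 1 by ring. replace (-1 * 1 + 1) with 0 by ring.
    apply ex_RInt_swap. eexists; now apply is_seg. }
  assert (H := is_RInt_comp_lin (V := C_R_NormedModule) _ _ _ _ _ _
     (RInt_correct (V := C_R_CompleteNormedModule) _ _ _ E)).
  replace (-1 * 0 + 1) with 1 in H by ring. replace (-1 * 1 + 1) with 0 in H by ring.
  eapply is_cint_ext; [|exact H].
  intros t _. simpl. rewrite scal_R_Cmult.
  replace (pt a b (-1 * t + 1)) with (pt b a t).
  - ring.
  - unfold pt. rewrite RtoC_plus, RtoC_mult. ring.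
Qed.

(** The parameter interval is cut at 1/2 and each half is rescaled to [0, 1]. *)
Lemma seg_mid (f : C -> C) (a b : C) :
  cont_disk f -> in_disk a -> in_disk b ->
  seg f a b = (seg f a (pt a b (/ 2)) + seg f (pt a b (/ 2)) b)%C.
Proof.
  intros Hf Ha Hb.
  assert (E : ex_RInt (V := C_R_CompleteNormedModule) (fun t => f (pt a b t) * (b - a))%C 0 1).
  { eexists; now apply is_seg. }
  assert (E1 := ex_RInt_Chasles_1 (V := C_R_CompleteNormedModule) _ 0 (/2) 1 ltac:(lra) E).
  assert (E2 := ex_RInt_Chasles_2 (V := C_R_CompleteNormedModule) _ 0 (/2) 1 ltac:(lra) E).
  assert (H := RInt_Chasles (V := C_R_CompleteNormedModule) _ 0 (/2) 1 E1 E2).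
  unfold seg at 1. rewrite <- H. change (@plus C_R_CompleteNormedModule) with Cplus.
  (* [ring] treats [RtoC (/2)] as an atom, so this identity has to be supplied by hand. *)
  assert (X : (RtoC (/2) + RtoC (/2) = 1)%C) by (rewrite <- RtoC_plus; f_equal; field).
  f_equal; symmetry; apply is_cint_unique.
  - replace 0 with (/2 * 0 + 0) in E1 at 1 by ring. replace (/2) with (/2 * 1 + 0) in E1 at 2 by ring.
    assert (K := is_RInt_comp_lin (V := C_R_NormedModule) _ _ _ _ _ _
      (RInt_correct (V := C_R_CompleteNormedModule) _ _ _ E1)).
    replace (/2 * 0 + 0) with 0 in K by ring. replace (/2 * 1 + 0) with (/2) in K by ring.
    eapply is_cint_ext; [|exact K].
    intros t _. simpl. rewrite scal_R_Cmult.
    replace (pt a b (/2 * t + 0)) with (pt a (pt a b (/2)) t).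
    + replace (pt a b (/2) - a)%C with (RtoC (/2) * (b - a))%C by (unfold pt; ring). ring.
    + unfold pt. rewrite Rplus_0_r, RtoC_mult. ring.
  - replace 1 with (/2 * 1 + /2) in E2 at 1 by field.
    replace (/2) with (/2 * 0 + /2) in E2 at 1 by ring.
    assert (K := is_RInt_comp_lin (V := C_R_NormedModule) _ _ _ _ _ _
      (RInt_correct (V := C_R_CompleteNormedModule) _ _ _ E2)).
    replace (/2 * 0 + /2) with (/2) in K by ring. replace (/2 * 1 + /2) with 1 in K by field.
    eapply is_cint_ext; [|exact K].
    intros t _. simpl. rewrite scal_R_Cmult.
    assert (Y : (b - pt a b (/2) = RtoC (/2) * (b - a))%C).
    { unfold pt. replace (b - (a + RtoC (/2) * (b - a)))%C with (1 * (b - a) - RtoC (/2) * (b - a))%C by ring.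
      rewrite <- X. ring. }
    replace (pt a b (/2 * t + /2)) with (pt (pt a b (/2)) b t).
    + rewrite Y. ring.
    + unfold pt at 1. rewrite Y. unfold pt. rewrite RtoC_plus, RtoC_mult. ring.
Qed.

(** Each edge of the medial triangle is traversed once in each direction, so the inner edges cancel
    and only the outer boundary remains. *)
Lemma tri_quadrisect (f : C -> C) (a b c : C) :
  cont_disk f -> in_disk a -> in_disk b -> in_disk c ->
  let mab := pt a b (/2) in let mbc := pt b c (/2) in let mca := pt c a (/2) in
  tri f a b c = (tri f a mab mca + tri f mab b mbc + tri f mca mbc c + tri f mab mbc mca)%C.
Proof.
  intros Hf Ha Hb Hc mab mbc mca.
  assert (Iab : in_disk mab) by (apply pt_in_disk; auto; lra).
  assert (Ibc : in_disk mbc) by (apply pt_in_disk; auto; lra).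
  assert (Ica : in_disk mca) by (apply pt_in_disk; auto; lra).
  unfold tri. rewrite (seg_mid f a b), (seg_mid f b c), (seg_mid f c a) by auto.
  fold mab mbc mca.
  rewrite (seg_swap f mab mca), (seg_swap f mbc mab), (seg_swap f mbc mca) by auto.
  ring.
Qed.

(** The intervals of radius 2K / 2^n about x n are nested, since a step of K / 2^n is exactly the
    loss of radius; [l] is the supremum of their left ends. The explicit rate is what Goursat's
    argument needs. *)
Lemma geometric_cauchy (x : nat -> R) (K : R) :
  (forall n, Rabs (x (S n) - x n) <= K / 2 ^ n) ->
  exists l, forall n, Rabs (x n - l) <= 2 * K / 2 ^ n.
Proof.
  intros H.
  assert (P : forall n, 0 < 2 ^ n) by (intros; apply pow_lt; lra).
  assert (HK : forall n, 2 * K / 2 ^ S n = K / 2 ^ n).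
  { intros n. simpl. field. specialize (P n). lra. }
  assert (HK2 : forall n, 2 * K / 2 ^ n = 2 * (K / 2 ^ n)) by (intros n; field; specialize (P n); lra).
  assert (Dec : forall n m, x (n + m)%nat + 2 * K / 2 ^ (n + m) <= x n + 2 * K / 2 ^ n).
  { intros n; induction m.
    - rewrite Nat.add_0_r. lra.
    - rewrite Nat.add_succ_r, HK.
      specialize (H (n + m)%nat). rewrite HK2 in IHm at 1. apply Rabs_le_between in H. lra. }
  assert (Inc : forall n m, x n - 2 * K / 2 ^ n <= x (n + m)%nat - 2 * K / 2 ^ (n + m)).
  { intros n; induction m.
    - rewrite Nat.add_0_r. lra.
    - rewrite Nat.add_succ_r, HK.
      specialize (H (n + m)%nat). rewrite (HK2 (n + m)%nat) in IHm. apply Rabs_le_between in H. lra. }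
  assert (HK0 : forall n, 0 <= 2 * K / 2 ^ n).
  { intros n. rewrite HK2. generalize (Rabs_pos (x (S n) - x n)) (H n). lra. }
  assert (Cross : forall n m, x n - 2 * K / 2 ^ n <= x m + 2 * K / 2 ^ m).
  { intros n m. generalize (Inc n m) (Dec m n) (HK0 (n + m)%nat). rewrite (Nat.add_comm m n). lra. }
  destruct (completeness (fun y => exists n, y = x n - 2 * K / 2 ^ n)) as [l [L1 L2]].
  - exists (x 0%nat + 2 * K / 2 ^ 0). intros y [n ->]. apply Cross.
  - exists (x 0%nat - 2 * K / 2 ^ 0). now exists 0%nat.
  - exists l. intros n. apply Rabs_le.
    assert (x n - 2 * K / 2 ^ n <= l) by (apply L1; eauto).
    assert (l <= x n + 2 * K / 2 ^ n) by (apply L2; intros y [m ->]; apply Cross).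
    lra.
Qed.

Lemma Cmod_le_sum (z : C) : Cmod z <= Rabs (fst z) + Rabs (snd z).
Proof.
  destruct z as [u v]; simpl.
  replace (u, v) with (RtoC u + Ci * RtoC v)%C.
  - eapply Rle_trans; [apply Cmod_triangle|]. rewrite Cmod_mult, Cmod_Ci, !Cmod_R. lra.
  - unfold RtoC, Ci, Cplus, Cmult; simpl. f_equal; ring.
Qed.

Lemma geometric_cauchy_C (x : nat -> C) (K : R) :
  (forall n, Cmod (x (S n) - x n)%C <= K / 2 ^ n) ->
  exists l, forall n, Cmod (x n - l)%C <= 4 * K / 2 ^ n.
Proof.
  intros H.
  destruct (geometric_cauchy (fun n => fst (x n)) K) as [u Hu].
  { intros n. eapply Rle_trans; [|apply H].
    eapply Rle_trans; [|apply Rmax_Cmod]. apply Rmax_l. }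
  destruct (geometric_cauchy (fun n => snd (x n)) K) as [v Hv].
  { intros n. eapply Rle_trans; [|apply H].
    eapply Rle_trans; [|apply Rmax_Cmod]. apply Rmax_r. }
  exists (u, v). intros n. eapply Rle_trans; [apply Cmod_le_sum|].
  replace (4 * K / 2 ^ n) with (2 * K / 2 ^ n + 2 * K / 2 ^ n) by (field; apply pow_nonzero; lra).
  apply Rplus_le_compat; [apply Hu|apply Hv].
Qed.

Lemma pow2_small (K eta : R) : 0 < eta -> exists n, K / 2 ^ n < eta.
Proof.
  intros He. destruct (pow_lt_1_zero (/2)) with (y := eta / (Rabs K + 1)) as [N HN].
  - rewrite Rabs_pos_eq; lra.
  - apply Rdiv_lt_0_compat; [lra|]. generalize (Rabs_pos K); lra.
  - exists N. specialize (HN N (Nat.le_refl _)). rewrite pow_inv in HN.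
    assert (0 < 2 ^ N) by (apply pow_lt; lra).
    assert (0 < / 2 ^ N) by now apply Rinv_0_lt_compat.
    rewrite Rabs_pos_eq in HN by lra.
    assert (0 <= Rabs K) by apply Rabs_pos.
    apply (Rmult_lt_compat_l (Rabs K + 1)) in HN; [|lra].
    replace ((Rabs K + 1) * (eta / (Rabs K + 1))) with eta in HN by (field; lra).
    unfold Rdiv. generalize (Rle_abs K). nra.
Qed.

(* Invariant of the quadrisection: the lower bound scales like [d ^ 2], whereas
   differentiability at the limit point makes the integral [o(d ^ 2)]. *)
Definition goursat_bad (f : C -> C) (rho eps : R) (p : C * C * C) (d : R) : Prop :=
  let '(a, b, c) := p in
  (Cmod a <= rho /\ Cmod b <= rho /\ Cmod c <= rho) /\
  (Cmod (b - a)%C <= d /\ Cmod (c - b)%C <= d /\ Cmod (a - c)%C <= d) /\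
  eps * d ^ 2 <= Cmod (tri f a b c).

Lemma pt_le (a b : C) (r t : R) : 0 <= t <= 1 ->
  Cmod a <= r -> Cmod b <= r -> Cmod (pt a b t) <= r.
Proof.
  intros Ht Ha Hb. generalize (pt_convex (RtoC 0) a b r t Ht).
  replace (a - 0)%C with a by ring. replace (b - 0)%C with b by ring.
  replace (pt a b t - 0)%C with (pt a b t) by ring. auto.
Qed.

Lemma half_Cmod (z w : C) (d : R) : (w = RtoC (/2) * z)%C -> Cmod z <= d -> Cmod w <= d / 2.
Proof.
  intros -> H. rewrite Cmod_mult, Cmod_R, Rabs_pos_eq by lra. lra.
Qed.

(** One of the four subtriangles carries at least a quarter of the integral, and halving [d] divides
    eps d^2 by exactly four. *)
Lemma goursat_bad_step (f : C -> C) (rho eps : R) (p : C * C * C) (d : R) :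
  cont_disk f -> rho < 1 -> 0 <= d -> goursat_bad f rho eps p d ->
  exists q, goursat_bad f rho eps q (d / 2) /\ Cmod (fst (fst q) - fst (fst p))%C <= d.
Proof.
  destruct p as [[a b] c]. intros Hf Hr Hd [[Ha [Hb Hc]] [[S1 [S2 S3]] HT]].
  assert (Q := tri_quadrisect f a b c Hf ltac:(red; lra) ltac:(red; lra) ltac:(red; lra)).
  cbv zeta in Q.
  set (mab := pt a b (/2)) in *. set (mbc := pt b c (/2)) in *. set (mca := pt c a (/2)) in *.
  assert (I : 0 <= /2 <= 1) by lra.
  assert (Mab : Cmod mab <= rho) by now apply pt_le.
  assert (Mbc : Cmod mbc <= rho) by now apply pt_le.
  assert (Mca : Cmod mca <= rho) by now apply pt_le.
  assert (X : (RtoC 1 = RtoC (/2) + RtoC (/2))%C) by (rewrite <- RtoC_plus; f_equal; field).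
  assert (X' : forall z : C, (z = RtoC (/2) * z + RtoC (/2) * z)%C).
  { intros z. transitivity (1 * z)%C; [ring|]. rewrite X. ring. }
  assert (HT4 : eps * d ^ 2 <= Cmod (tri f a mab mca) + Cmod (tri f mab b mbc)
              + Cmod (tri f mca mbc c) + Cmod (tri f mab mbc mca)).
  { eapply Rle_trans; [apply HT|]. rewrite Q.
    eapply Rle_trans; [apply Cmod_triangle|]. apply Rplus_le_compat_r.
    eapply Rle_trans; [apply Cmod_triangle|]. apply Rplus_le_compat_r.
    apply Cmod_triangle. }
  assert (E1 : (mab - a = RtoC (/2) * (b - a))%C) by (unfold mab, pt; ring).
  assert (E2 : (b - mab = RtoC (/2) * (b - a))%C).
  { unfold mab, pt. rewrite (X' b) at 1. rewrite (X' a) at 1. ring. }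
  assert (E3 : (mbc - b = RtoC (/2) * (c - b))%C) by (unfold mbc, pt; ring).
  assert (E4 : (c - mbc = RtoC (/2) * (c - b))%C).
  { unfold mbc, pt. rewrite (X' b) at 1. rewrite (X' c) at 1. ring. }
  assert (E5 : (mca - c = RtoC (/2) * (a - c))%C) by (unfold mca, pt; ring).
  assert (E6 : (a - mca = RtoC (/2) * (a - c))%C).
  { unfold mca, pt. rewrite (X' a) at 1. rewrite (X' c) at 1. ring. }
  (* Each edge of the medial triangle is half of the parallel side. *)
  assert (E7 : (mca - mab = RtoC (/2) * (c - b))%C).
  { transitivity ((mca - c) + (c - b) + (b - mab))%C; [ring|].
    rewrite E5, E2. rewrite (X' (c - b)%C) at 1. ring. }
  assert (E8 : (mab - mbc = RtoC (/2) * (a - c))%C).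
  { transitivity ((mab - a) + (a - c) + (c - mbc))%C; [ring|].
    rewrite E1, E4. rewrite (X' (a - c)%C) at 1. ring. }
  assert (E9 : (mbc - mca = RtoC (/2) * (b - a))%C).
  { transitivity ((mbc - b) + (b - a) + (a - mca))%C; [ring|].
    rewrite E3, E6. rewrite (X' (b - a)%C) at 1. ring. }
  assert (D : forall z w, (w = RtoC (/2) * z)%C -> Cmod z <= d -> Cmod w <= d / 2 /\ Cmod (-w)%C <= d / 2).
  { intros z w Hz H. rewrite Cmod_opp. split; eapply half_Cmod; eauto. }
  destruct (D _ _ E1 S1) as [G1 G1']. destruct (D _ _ E2 S1) as [G2 G2'].
  destruct (D _ _ E3 S2) as [G3 G3']. destruct (D _ _ E4 S2) as [G4 G4'].
  destruct (D _ _ E5 S3) as [G5 G5']. destruct (D _ _ E6 S3) as [G6 G6'].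
  destruct (D _ _ E7 S2) as [G7 G7']. destruct (D _ _ E8 S3) as [G8 G8'].
  destruct (D _ _ E9 S1) as [G9 G9'].
  replace (- (mca - mab))%C with (mab - mca)%C in G7' by ring.
  replace (- (mab - mbc))%C with (mbc - mab)%C in G8' by ring.
  replace (- (mbc - mca))%C with (mca - mbc)%C in G9' by ring.
  replace (- (a - mca))%C with (mca - a)%C in G6' by ring.
  assert (Z : Cmod (a - a)%C <= d) by (replace (a - a)%C with (RtoC 0) by ring; rewrite Cmod_0; lra).
  assert (Hq : eps * (d / 2) ^ 2 = eps * d ^ 2 / 4) by field.
  destruct (Rle_dec (eps * d ^ 2 / 4) (Cmod (tri f a mab mca))).
  { exists (a, mab, mca). unfold goursat_bad; simpl fst; simpl snd. rewrite Hq. repeat split; auto; lra. }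
  destruct (Rle_dec (eps * d ^ 2 / 4) (Cmod (tri f mab b mbc))).
  { exists (mab, b, mbc). unfold goursat_bad; simpl fst; simpl snd. rewrite Hq. repeat split; auto; lra. }
  destruct (Rle_dec (eps * d ^ 2 / 4) (Cmod (tri f mca mbc c))).
  { exists (mca, mbc, c). unfold goursat_bad; simpl fst; simpl snd. rewrite Hq. repeat split; auto; lra. }
  { exists (mab, mbc, mca). unfold goursat_bad; simpl fst; simpl snd. rewrite Hq. repeat split; auto; lra. }
Qed.

(** Dependent choice: the invariant varies with n, so the recursion runs over triangles paired with
    their proofs. *)
Lemma goursat_bad_sequence (f : C -> C) (rho eps d : R) (p : C * C * C) :
  cont_disk f -> rho < 1 -> 0 <= d -> goursat_bad f rho eps p d ->
  exists q : nat -> C * C * C, forall n,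
    goursat_bad f rho eps (q n) (d / 2 ^ n) /\
    Cmod (fst (fst (q (S n))) - fst (fst (q n)))%C <= d / 2 ^ n.
Proof.
  intros Hf Hr Hd Hp.
  assert (P : forall n, 0 < 2 ^ n) by (intros; apply pow_lt; lra).
  assert (step : forall n (s : {p | goursat_bad f rho eps p (d / 2 ^ n)}),
    {q : C * C * C | goursat_bad f rho eps q (d / 2 ^ S n) /\
       Cmod (fst (fst q) - fst (fst (proj1_sig s)))%C <= d / 2 ^ n}).
  { intros n [s Hs]. apply constructive_indefinite_description. simpl proj1_sig.
    replace (d / 2 ^ S n) with (d / 2 ^ n / 2) by (simpl; field; specialize (P n); lra).
    apply goursat_bad_step; auto. apply Rmult_le_pos; [lra|]. left. apply Rinv_0_lt_compat, P. }
  assert (H0 : goursat_bad f rho eps p (d / 2 ^ 0)) by (simpl; now rewrite Rdiv_1_r).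
  set (s := fix s n : {p | goursat_bad f rho eps p (d / 2 ^ n)} :=
    match n with
    | O => exist _ p H0
    | S m => exist _ (proj1_sig (step m (s m))) (proj1 (proj2_sig (step m (s m))))
    end).
  exists (fun n => proj1_sig (s n)). intros n. split.
  - exact (proj2_sig (s n)).
  - exact (proj2 (proj2_sig (step n (s n)))).
Qed.

(** A nonzero integral would produce shrinking bad triangles converging to a point z. Near z the
    function is affine up to o(|x - z|), and the affine part has a primitive, so the integrals are
    too small for the invariant. *)
Lemma goursat (f : C -> C) (a b c : C) :
  hol f -> in_disk a -> in_disk b -> in_disk c -> tri f a b c = RtoC 0.
Proof.
  intros Hol Ha Hb Hc. assert (Hf := hol_cont f Hol).
  apply Cmod_eq_0. apply Rle_antisym; [|apply Cmod_ge_0].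
  apply Rnot_lt_le. intros HT.
  set (T := Cmod (tri f a b c)) in *.
  (* The added 1 keeps [d] positive for degenerate triangles; [eps] then makes the initial invariant
     an equality. *)
  set (d := Cmod (b - a)%C + Cmod (c - b)%C + Cmod (a - c)%C + 1).
  assert (A1 := Cmod_ge_0 (b - a)%C). assert (A2 := Cmod_ge_0 (c - b)%C). assert (A3 := Cmod_ge_0 (a - c)%C).
  assert (Hd : 0 < d) by (unfold d; lra).
  set (eps := T / d ^ 2).
  assert (Hd2 : 0 < d ^ 2) by (apply pow_lt; lra).
  assert (He : 0 < eps) by (now apply Rdiv_lt_0_compat).
  set (rho := Rmax (Cmod a) (Rmax (Cmod b) (Cmod c))).
  assert (Hr : rho < 1) by (unfold rho; repeat apply Rmax_lub_lt; auto).
  assert (Hbad : goursat_bad f rho eps (a, b, c) d).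
  { unfold goursat_bad. repeat split; try (unfold d; lra).
    - apply Rmax_l.
    - eapply Rle_trans; [|apply Rmax_r]. apply Rmax_l.
    - eapply Rle_trans; [|apply Rmax_r]. apply Rmax_r.
    - unfold eps. fold T. right. field. lra. }
  destruct (goursat_bad_sequence f rho eps d _ Hf Hr (Rlt_le _ _ Hd) Hbad) as [q Hq].
  destruct (geometric_cauchy_C (fun n => fst (fst (q n))) d) as [z Hz].
  { intros n. apply Hq. }
  (* All vertices stay in the closed disk of radius [rho] < 1, hence so does their limit. *)
  assert (Hzr : in_disk z).
  { red. apply Rle_lt_trans with rho; auto. apply Rnot_lt_le. intros Hlt.
    destruct (pow2_small (4 * d) (Cmod z - rho)) as [n Hn]; [lra|].
    specialize (Hz n). destruct (Hq n) as [Hb' _].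
    destruct (q n) as [[u v] w]. simpl in Hz. destruct Hb' as [[Hu _] _].
    generalize (Cmod_reverse z u). rewrite Cmod_minus_sym. lra. }
  destruct (Hol z Hzr) as [l Hl]. assert (Hl' := Hl). rewrite hder_iff in Hl'.
  (* With sides at most e and all points within 6e of z (4e for the first vertex, plus a side,
     rounded up), each side contributes at most (eps/19) 6e e. The total 18/19 eps e^2 contradicts
     the invariant. *)
  destruct (Hl' (eps / 19)) as [delta [Hd0 Hdel]]; [lra|].
  destruct (pow2_small (6 * d) delta Hd0) as [n Hn].
  specialize (Hz n). destruct (Hq n) as [Hb' _].
  destruct (q n) as [[u v] w]. simpl in Hz.
  destruct Hb' as [[Hu [Hv Hw]] [[S1 [S2 S3]] HTn]].
  assert (Hp2 : 0 < 2 ^ n) by (apply pow_lt; lra).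
  set (e := d / 2 ^ n) in *.
  replace (4 * d / 2 ^ n) with (4 * e) in Hz by (unfold e; field; lra).
  replace (6 * d / 2 ^ n) with (6 * e) in Hn by (unfold e; field; lra).
  assert (He0 : 0 < e) by (now apply Rdiv_lt_0_compat).
  set (Aff := fun x : C => (f z + (x - z) * l)%C).
  set (Prim := fun x : C => (f z * x + RtoC (/2) * ((x - z) * (x - z)) * l)%C).
  assert (HA : forall x, hder Aff x l).
  { intros x. unfold Aff. eapply hder_eq.
    apply hder_plus; [apply hder_const|]. apply hder_mult; [|apply hder_const].
    apply hder_minus; [apply hder_id|apply hder_const]. cbv beta; ring. }
  assert (Hh : (RtoC (/2) + RtoC (/2) = 1)%C) by (rewrite <- RtoC_plus; f_equal; field).
  assert (HP : forall x, hder Prim x (Aff x)).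
  { intros x. unfold Prim, Aff.
    assert (J : hder (fun w0 : C => w0 - z)%C x (RtoC 1)).
    { eapply hder_eq. apply hder_minus; [apply hder_id|apply hder_const]. cbv beta; ring. }
    eapply hder_eq.
    apply hder_plus.
    - apply hder_mult; [apply hder_const|apply hder_id].
    - apply hder_mult; [|apply hder_const].
      apply hder_mult; [apply hder_const|]. apply hder_mult; apply J.
    - cbv beta. transitivity (f z + (RtoC (/2) + RtoC (/2)) * ((x - z) * l))%C; [ring|]. rewrite Hh. ring. }
  assert (HcA : cont_disk Aff) by (intros x _; eapply hder_ccont; apply HA).
  assert (key : forall x y, Cmod x <= rho -> Cmod y <= rho -> Cmod (y - x)%C <= e ->
     Cmod (x - z)%C <= 6 * e -> Cmod (y - z)%C <= 6 * e ->
     Cmod (seg f x y - (Prim y - Prim x))%C <= eps / 19 * (6 * e) * e).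
  { intros x y Hx Hy Hxy Hxz Hyz.
    assert (Dx : in_disk x) by (red; lra). assert (Dy : in_disk y) by (red; lra).
    rewrite <- (seg_primitive Prim Aff x y) by auto.
    rewrite <- seg_minus by auto.
    eapply Rle_trans; [apply seg_bound with (M := eps / 19 * (6 * e)); auto|].
    - intros x0 Hx0. apply (ccont_minus CU); auto.
    - intros t Ht.
      assert (Hpt : Cmod (pt x y t - z)%C <= 6 * e) by now apply pt_convex.
      unfold Aff.
      replace (f (pt x y t) - (f z + (pt x y t - z) * l))%C
        with (f (pt x y t) - f z - (pt x y t - z) * l)%C by ring.
      eapply Rle_trans; [apply Hdel; lra|]. apply Rmult_le_compat_l; lra.
    - apply Rmult_le_compat_l; [|lra]. apply Rmult_le_pos; lra. }
  assert (Hvz : Cmod (v - z)%C <= 6 * e).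
  { replace (v - z)%C with ((v - u) + (u - z))%C by ring.
    eapply Rle_trans; [apply Cmod_triangle|]. lra. }
  assert (Hwz : Cmod (w - z)%C <= 6 * e).
  { replace (w - z)%C with ((u - z) - (u - w))%C by ring.
    unfold Cminus at 1. eapply Rle_trans; [apply Cmod_triangle|]. rewrite Cmod_opp. lra. }
  assert (K1 := key u v Hu Hv S1 ltac:(lra) Hvz).
  assert (K2 := key v w Hv Hw S2 Hvz Hwz).
  assert (K3 := key w u Hw Hu S3 Hwz ltac:(lra)).
  assert (Cmod (tri f u v w) <= 18 * (eps / 19) * e ^ 2).
  { unfold tri.
    replace (seg f u v + seg f v w + seg f w u)%C with
     ((seg f u v - (Prim v - Prim u)) + (seg f v w - (Prim w - Prim v)) + (seg f w u - (Prim u - Prim w)))%C by ring.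
    eapply Rle_trans; [apply Cmod_triangle|].
    eapply Rle_trans; [apply Rplus_le_compat_r; apply Cmod_triangle|]. simpl. nra. }
  assert (0 < eps * e ^ 2) by (apply Rmult_lt_0_compat; [auto|apply pow_lt; auto]).
  lra.
Qed.

(** Goursat on the triangle 0, z, w turns the increment of the primitive into the integral of f from
    z to w. Comparison with the constant f z leaves only the oscillation of f near z. *)
Lemma primitive_disk (f : C -> C) :
  hol f -> forall z, in_disk z -> hder (seg f (RtoC 0)) z (f z).
Proof.
  intros Hol z Hz. assert (Hf := hol_cont f Hol).
  assert (D0 : in_disk (RtoC 0)) by (red; rewrite Cmod_0; lra).
  apply hder_iff. intros eps He.
  destruct (proj1 (ccont_C f z) (Hf z Hz) eps He) as [d [Hd H]].
  exists (Rmin d (1 - Cmod z)). split. apply Rmin_pos; auto. red in Hz; lra.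
  intros w Hw.
  assert (W1 := Rlt_le_trans _ _ _ Hw (Rmin_l _ _)).
  assert (W2 := Rlt_le_trans _ _ _ Hw (Rmin_r _ _)).
  assert (Dw : in_disk w) by (red; generalize (Cmod_reverse w z); lra).
  assert (HG := goursat f _ _ _ Hol D0 Hz Dw). unfold tri in HG.
  rewrite (seg_swap f (RtoC 0) w) in HG by auto.
  assert (E : (seg f 0 w - seg f 0 z)%C = seg f z w).
  { transitivity (seg f 0 w - seg f 0 z + (seg f 0 z + seg f z w + - seg f 0 w))%C;
    [rewrite HG; ring|ring]. }
  rewrite E.
  assert (Ec : seg (fun _ => f z) z w = (f z * w - f z * z)%C).
  { apply (seg_primitive (fun x => f z * x)%C (fun _ => f z)); auto.
    - intros x _. apply (ccont_const CU).
    - intros t _. eapply hder_eq. apply hder_mult; [apply hder_const|apply hder_id]. cbv beta; ring. }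
  replace (seg f z w - (w - z) * f z)%C with (seg f z w - seg (fun _ => f z) z w)%C
    by (rewrite Ec; ring).
  rewrite <- seg_minus; auto.
  - apply seg_bound; auto.
    + intros x Hx. apply (ccont_minus CU); auto. apply (ccont_const CU).
    + intros t Ht. left. apply H. eapply Rle_lt_trans; [|apply W1].
      apply pt_convex; auto; [|lra].
      replace (z - z)%C with (RtoC 0) by ring. rewrite Cmod_0. apply Cmod_ge_0.
  - intros x _. apply (ccont_const CU).
Qed.

(** * Cauchy's integral formula *)

Lemma rder_pair (u v : R -> R) (t a b : R) :
  is_derive u t a -> is_derive v t b -> rder (fun s => (u s, v s)) t (a, b).
Proof.
  intros Hu Hv. apply rder_iff. intros eps He.
  assert (He2 : 0 < eps / 2) by lra.
  destruct Hu as [_ Hu]. destruct Hv as [_ Hv].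
  destruct (Hu t (fun P HP => HP) (mkposreal _ He2)) as [d1 H1].
  destruct (Hv t (fun P HP => HP) (mkposreal _ He2)) as [d2 H2].
  exists (Rmin d1 d2). split; [apply Rmin_pos; apply cond_pos|].
  intros w Hw.
  assert (W1 := H1 w (Rlt_le_trans _ _ _ Hw (Rmin_l _ _))).
  assert (W2 := H2 w (Rlt_le_trans _ _ _ Hw (Rmin_r _ _))).
  eapply Rle_trans; [apply Cmod_le_sum|]. simpl.
  replace (eps * Rabs (w - t)) with (eps / 2 * Rabs (w - t) + eps / 2 * Rabs (w - t)) by field.
  apply Rplus_le_compat.
  - eapply Rle_trans; [|apply W1]. right.
    change (Rabs (u w + - u t + - ((w - t) * a - 0 * b)) = Rabs (u w + - u t + - ((w - t) * a))).
    f_equal. ring.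
  - eapply Rle_trans; [|apply W2]. right.
    change (Rabs (v w + - v t + - ((w - t) * b + 0 * a)) = Rabs (v w + - v t + - ((w - t) * b))).
    f_equal. ring.
Qed.

(** * Integrals over circles about the origin *)

Definition circ (r theta : R) : C := (RtoC r * cexpi theta)%C.

Lemma Cmod_cexpi (t : R) : Cmod (cexpi t) = 1.
Proof.
  unfold Cmod, cexpi; simpl. replace (_ + _) with 1. apply sqrt_1.
  generalize (sin2_cos2 t). unfold Rsqr. lra.
Qed.

Lemma Cmod_circ (r t : R) : 0 <= r -> Cmod (circ r t) = r.
Proof. intros Hr. unfold circ. rewrite Cmod_mult, Cmod_R, Cmod_cexpi, Rabs_pos_eq; lra. Qed.

Lemma rder_eq (f : R -> C) (t : R) (l l' : C) : rder f t l -> l = l' -> rder f t l'.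
Proof. now intros H <-. Qed.

Lemma rder_cexpi (t : R) : rder cexpi t (Ci * cexpi t)%C.
Proof.
  replace (Ci * cexpi t)%C with (- sin t, cos t).
  - apply (rder_pair cos sin); [apply is_derive_cos|apply is_derive_sin].
  - unfold Ci, cexpi, Cmult; simpl. f_equal; ring.
Qed.

Lemma rder_circ (r t : R) : rder (circ r) t (Ci * circ r t)%C.
Proof.
  unfold circ. eapply rder_eq.
  - apply (hder_rder_comp (fun z => RtoC r * z)%C cexpi t (RtoC r)).
    + eapply hder_eq. apply hder_mult; [apply hder_const|apply hder_id]. cbv beta; ring.
    + apply rder_cexpi.
  - ring.
Qed.

Lemma ccont_circ (r t : R) : @continuous R_UniformSpace CU (circ r) t.
Proof. eapply rder_ccont. apply rder_circ. Qed.

Lemma circ_2PI (r : R) : circ r (2 * PI) = circ r 0.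
Proof. unfold circ, cexpi. now rewrite cos_2PI, sin_2PI, cos_0, sin_0. Qed.

Lemma circ_dist (r t : R) (a : C) : 0 <= r -> r - Cmod a <= Cmod (circ r t - a)%C.
Proof. intros Hr. generalize (Cmod_reverse (circ r t) a). now rewrite Cmod_circ. Qed.

Lemma circ_neq (r t : R) (a : C) : Cmod a < r -> (circ r t - a)%C <> RtoC 0.
Proof.
  intros H. apply Cmod_gt_0. generalize (Cmod_ge_0 a); intros.
  generalize (circ_dist r t a). lra.
Qed.

Lemma circ_in_disk (r t : R) : 0 <= r < 1 -> in_disk (circ r t).
Proof. intros H. red. rewrite Cmod_circ; lra. Qed.

Lemma twopi_pos : 0 <= 2 * PI.
Proof. generalize PI_RGT_0; lra. Qed.

(** Integration is over the angle, d theta = d zeta / (i zeta). Cauchy's kernel d zeta / (i (zeta -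
    a)) therefore appears as zeta / (zeta - a). *)
Notation loop u := (cint u 0 (2 * PI)).

Definition rcont (u : R -> C) : Prop := forall t, @continuous R_UniformSpace CU u t.

Lemma is_loop (u : R -> C) : rcont u -> is_cint u 0 (2 * PI) (loop u).
Proof. intros H. apply cint_correct. intros t _. apply H. Qed.

Lemma loop_derive_0 (u du : R -> C) :
  (forall t, rder u t (du t)) -> rcont du -> u 0 = u (2 * PI) -> loop du = RtoC 0.
Proof.
  intros H1 H2 H3. apply is_cint_unique.
  replace (RtoC 0) with (u (2 * PI)%R - u 0%R)%C by (rewrite H3; ring).
  apply is_cint_derive; auto.
Qed.

Lemma loop_scal (c : C) (u : R -> C) : rcont u -> loop (fun t => c * u t)%C = (c * loop u)%C.
Proof. intros H. apply is_cint_unique, is_cint_scal, is_loop, H. Qed.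

Lemma loop_bound (u : R -> C) (M : R) : rcont u ->
  (forall t, 0 <= t <= 2 * PI -> Cmod (u t) <= M) -> Cmod (loop u) <= 2 * PI * M.
Proof.
  intros H HM. replace (2 * PI * M) with ((2 * PI - 0) * M) by ring.
  eapply is_cint_bound; [apply twopi_pos|exact HM|now apply is_loop].
Qed.

Lemma loop_ext (u v : R -> C) : (forall t, u t = v t) -> loop u = loop v.
Proof. intros H. apply (RInt_ext (V := C_R_CompleteNormedModule)). intros t _. apply H. Qed.

Lemma loop_minus (u v : R -> C) : rcont u -> rcont v ->
  loop (fun t => u t - v t)%C = (loop u - loop v)%C.
Proof. intros Hu Hv. apply is_cint_unique, is_cint_minus; now apply is_loop. Qed.

Lemma rcont_pow (u : R -> C) (m : nat) : rcont u -> rcont (fun t => u t ^ m)%C.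
Proof.
  intros Hu. induction m; intros t; simpl.
  - apply (ccont_const R_UniformSpace).
  - apply (ccont_mult R_UniformSpace); auto.
Qed.

Lemma rcont_mult (u v : R -> C) : rcont u -> rcont v -> rcont (fun t => u t * v t)%C.
Proof. intros Hu Hv t. now apply (ccont_mult R_UniformSpace). Qed.

Lemma rcont_const (c : C) : rcont (fun _ => c).
Proof. intros t. apply (ccont_const R_UniformSpace). Qed.

Lemma rcont_resolvent (r : R) (a : C) : Cmod a < r -> rcont (fun t => / (circ r t - a))%C.
Proof.
  intros Ha t. apply (ccont_inv R_UniformSpace).
  - apply (ccont_minus R_UniformSpace); [apply ccont_circ|apply (ccont_const R_UniformSpace)].
  - now apply circ_neq.
Qed.

Lemma rcont_bounded (u : R -> C) (a b : R) : rcont u -> exists M, 0 <= M /\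
  forall t, a <= t <= b -> Cmod (u t) <= M.
Proof.
  intros Hu.
  destruct (bounded_continuity (K := C_AbsRing) (V := CV) u a b) as [M HM].
  - intros x _. apply Hu.
  - exists (Rabs M). split; [apply Rabs_pos|]. intros t Ht. left.
    eapply Rlt_le_trans; [apply (HM t Ht)|apply Rle_abs].
Qed.

(** Meant for X = 1/(zeta - b), Y = 1/(zeta - a), h = b - a, for which the hypothesis is the
    resolvent identity. [K] depends only on m and A, so the expansion is uniform over the circle. *)
Lemma pow_resolvent_taylor (m : nat) (A : R) : 0 <= A ->
  exists K, 0 <= K /\ forall X Y h : C, Cmod X <= A -> Cmod Y <= A -> (X - Y = h * X * Y)%C ->
    Cmod (X ^ m - Y ^ m - h * (RtoC (INR m) * Y ^ S m))%C <= K * (Cmod h * Cmod h).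
Proof.
  intros HA. induction m as [|m [K [HK IH]]].
  - exists 0. split; [lra|]. intros X Y h _ _ _. simpl.
    replace (1 - 1 - h * (0 * (Y * 1)))%C with (RtoC 0) by ring. rewrite Cmod_0. lra.
  - exists (INR (S m) * A ^ (m + 3) + A * K).
    assert (0 <= A ^ (m + 3)) by now apply pow_le.
    assert (0 <= INR (S m)) by apply pos_INR.
    split. { apply Rplus_le_le_0_compat; apply Rmult_le_pos; auto. }
    intros X Y h HX HY E. specialize (IH X Y h HX HY E).
    set (Em := (X ^ m - Y ^ m - h * (RtoC (INR m) * Y ^ S m))%C) in *.
    (* Using the resolvent identity twice exhibits the new remainder as a term in h^2 plus X times
       the old remainder. *)
    replace (X ^ S m - Y ^ S m - h * (RtoC (INR (S m)) * Y ^ S (S m)))%C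
      with (RtoC (INR (S m)) * (h * h) * (X * Y ^ (m + 2)) + X * Em)%C.
    2:{ unfold Em. rewrite S_INR, RtoC_plus.
        replace (Y ^ (m + 2))%C with (Y * Y * Y ^ m)%C by (rewrite Nat.add_comm; simpl; ring).
        simpl. set (n := RtoC (INR m)). set (Ym := (Y ^ m)%C). set (Xm := (X ^ m)%C).
        transitivity ((n + 1) * h * (h * X * Y) * Y * Ym + X * (Xm - Ym - h * (n * (Y * Ym))))%C; [ring|].
        rewrite <- E.
        transitivity (X * Xm - Y * Ym - h * ((n + 1) * (Y * (Y * Ym))) - Ym * (X - Y) + h * X * Y * Ym)%C; [ring|].
        rewrite <- E. ring. }
    eapply Rle_trans; [apply Cmod_triangle|].
    rewrite Rmult_plus_distr_r. apply Rplus_le_compat.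
    + rewrite !Cmod_mult, Cmod_R, Rabs_pos_eq, Cmod_pow by auto.
      replace (INR (S m) * A ^ (m + 3) * (Cmod h * Cmod h))
        with (INR (S m) * (Cmod h * Cmod h) * A ^ (m + 3)) by ring.
      apply Rmult_le_compat_l.
      * repeat apply Rmult_le_pos; auto; apply Cmod_ge_0.
      * replace (m + 3)%nat with (S (m + 2)) by lia. simpl.
        apply Rmult_le_compat; auto; try apply Cmod_ge_0.
        { apply pow_le, Cmod_ge_0. }
        { apply pow_incr. split; auto. apply Cmod_ge_0. }
    + rewrite Cmod_mult, Rmult_assoc. apply Rmult_le_compat; auto; apply Cmod_ge_0.
Qed.

(** * Cauchy-type integrals and differentiation under the integral sign *)

Section Kernel.

Variables (r : R) (phi : R -> C).
Hypothesis Hr : 0 < r.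
Hypothesis Hphi : rcont phi.

Definition kernel (m : nat) (a : C) : C := loop (fun t => phi t * (/ (circ r t - a)) ^ m)%C.

(** Differentiation under the integral for an arbitrary continuous density; the derivative is again
    a kernel, so every kernel is infinitely differentiable inside the circle. *)
Lemma hder_kernel (m : nat) (a : C) : Cmod a < r ->
  hder (kernel m) a (RtoC (INR m) * kernel (S m) a)%C.
Proof.
  intros Ha. assert (Ha0 := Cmod_ge_0 a).
  set (d := r - Cmod a). assert (Hd : 0 < d) by (unfold d; lra).
  assert (HA : 0 <= 2 / d) by (left; apply Rdiv_lt_0_compat; lra).
  destruct (pow_resolvent_taylor m (2 / d) HA) as [K [HK HT]].
  destruct (rcont_bounded phi 0 (2 * PI) Hphi) as [M [HM HMb]].
  apply hder_iff. intros eps He.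
  set (B := 2 * PI * (M * K) + 1).
  assert (HB : 0 < B).
  { unfold B. assert (0 <= 2 * PI * (M * K)); [|lra].
    apply Rmult_le_pos; [apply twopi_pos|now apply Rmult_le_pos]. }
  (* Within d/2 of a, points keep distance d/2 from the circle, so 2/d bounds both resolvents; eps/B
     absorbs the quadratic remainder. The 1 in [B] only ensures positivity. *)
  exists (Rmin (d / 2) (eps / B)). split.
  { apply Rmin_pos; [lra|now apply Rdiv_lt_0_compat]. }
  intros b Hb.
  assert (H1 := Rlt_le_trans _ _ _ Hb (Rmin_l _ _)).
  assert (H2 := Rlt_le_trans _ _ _ Hb (Rmin_r _ _)).
  assert (Hbr : Cmod b < r).
  { generalize (Cmod_reverse b a). unfold d in *. lra. }
  assert (HRb := rcont_mult _ _ Hphi (rcont_pow _ m (rcont_resolvent r b Hbr))).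
  assert (HRa := rcont_mult _ _ Hphi (rcont_pow _ m (rcont_resolvent r a Ha))).
  assert (HRa' := rcont_mult _ _ Hphi (rcont_pow _ (S m) (rcont_resolvent r a Ha))).
  cbv beta in HRb, HRa, HRa'.
  set (h := (b - a)%C) in *.
  unfold kernel.
  rewrite <- loop_minus by auto.
  replace (h * (INR m * loop (fun t : R => phi t * (/ (circ r t - a)) ^ S m)))%C
    with (h * INR m * loop (fun t : R => phi t * (/ (circ r t - a)) ^ S m))%C by ring.
  rewrite <- loop_scal by auto.
  rewrite <- loop_minus; [| |apply rcont_mult; [apply rcont_const|auto]].
  2:{ intros t. apply (ccont_minus R_UniformSpace); auto. }
  eapply Rle_trans; [apply loop_bound with (M := M * (K * (Cmod h * Cmod h)))|].
  - intros t. apply (ccont_minus R_UniformSpace).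
    + apply (ccont_minus R_UniformSpace); auto.
    + apply rcont_mult; [apply rcont_const|auto].
  - intros t Ht.
    assert (Na := circ_neq r t a Ha). assert (Nb := circ_neq r t b Hbr).
    set (X := (/ (circ r t - b))%C). set (Y := (/ (circ r t - a))%C).
    replace (phi t * X ^ m - phi t * Y ^ m - h * INR m * (phi t * Y ^ S m))%C
      with (phi t * (X ^ m - Y ^ m - h * (INR m * Y ^ S m)))%C by ring.
    rewrite Cmod_mult. apply Rmult_le_compat; auto; try apply Cmod_ge_0.
    assert (HI : forall c, (circ r t - c)%C <> RtoC 0 -> d / 2 <= Cmod (circ r t - c)%C ->
       Cmod (/ (circ r t - c))%C <= 2 / d).
    { intros c Hc Hdc. rewrite Cmod_inv by auto.
      replace (2 / d) with (/ (d / 2)) by (field; lra).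
      apply Rinv_le_contravar; lra. }
    apply HT.
    + apply HI; auto. generalize (circ_dist r t b). generalize (Cmod_reverse b a). fold h. unfold d in *. lra.
    + apply HI; auto. generalize (circ_dist r t a). unfold d in *. lra.
    + unfold X, Y, h. field. auto.
  - assert (0 <= Cmod h) by apply Cmod_ge_0.
    assert (B * Cmod h <= eps).
    { apply Rle_trans with (B * (eps / B)); [apply Rmult_le_compat_l; lra|]. right; field; lra. }
    apply Rle_trans with (B * Cmod h * Cmod h).
    + unfold B. nra.
    + apply Rmult_le_compat_r; auto.
Qed.

End Kernel.

Lemma Copp_Ci_mult_eq_0 (z : C) : (- Ci * z)%C = RtoC 0 -> z = RtoC 0.
Proof.
  intros H. transitivity (Ci * (- Ci * z))%C; [|rewrite H; ring].
  unfold Ci, Cmult, Copp. destruct z; simpl. f_equal; ring.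
Qed.

(** As a function of a, the integral has derivative 0, because zeta / (zeta - a)^2 is, up to the
    factor -i, the angular derivative of 1/(zeta - a). Hence it equals its value at 0, where the
    integrand is 1. *)
Lemma loop_winding (r : R) (a : C) : 0 < r < 1 -> Cmod a < r ->
  loop (fun t => circ r t * / (circ r t - a))%C = RtoC (2 * PI).
Proof.
  intros Hr Ha.
  set (W := kernel r (circ r) 1).
  assert (Hc : rcont (circ r)) by (intros t; apply ccont_circ).
  assert (HW : forall b, Cmod b < r -> hder W b (RtoC 0)).
  { intros b Hb. eapply hder_eq; [apply hder_kernel; [lra|auto|auto]|].
    replace (kernel r (circ r) 2 b) with (RtoC 0); [ring|].
    symmetry. unfold kernel.
    assert (HR := rcont_resolvent r b Hb).
    assert (Hk : rcont (fun t => circ r t * (/ (circ r t - b)) ^ 2)%C).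
    { apply rcont_mult; auto. apply rcont_pow; auto. }
    assert (Z : loop (fun t => - Ci * (circ r t * (/ (circ r t - b)) ^ 2))%C = RtoC 0).
    { apply loop_derive_0 with (u := fun t => (/ (circ r t - b))%C).
      - intros t. eapply rder_eq.
        + apply (hder_rder_comp (fun z => / (z - b))%C (circ r) t).
          * apply hder_inv; [|now apply circ_neq].
            apply hder_minus; [apply hder_id|apply hder_const].
          * apply rder_circ.
        + assert (N := circ_neq r t b Hb). cbv beta. simpl. field. auto.
      - apply rcont_mult; auto. apply rcont_const.
      - now rewrite circ_2PI. }
    rewrite loop_scal in Z by auto.
    apply Copp_Ci_mult_eq_0. exact Z. }
  assert (D0 : in_disk (RtoC 0)) by (red; rewrite Cmod_0; lra).
  assert (Da : in_disk a) by (red; lra).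
  assert (Cz : cont_disk (fun _ => RtoC 0)) by (intros z _; apply (ccont_const CU)).
  assert (E := seg_primitive W (fun _ => RtoC 0) (RtoC 0) a Cz D0 Da).
  assert (S0 : seg (fun _ => RtoC 0) (RtoC 0) a = RtoC 0).
  { apply Cmod_eq_0, Rle_antisym; [|apply Cmod_ge_0].
    apply Rle_trans with (0 * Cmod (a - 0)%C); [|lra].
    apply seg_bound; auto. intros t _. rewrite Cmod_0. lra. }
  rewrite S0 in E.
  assert (EW : W a = W (RtoC 0)).
  { transitivity (W a - W (RtoC 0) + W (RtoC 0))%C; [ring|]. rewrite <- E; [ring|].
    intros t Ht. apply HW. eapply Rle_lt_trans; [|apply Ha].
    apply pt_le; auto; [|lra]. rewrite Cmod_0. apply Cmod_ge_0. }
  transitivity (W a).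
  { apply loop_ext. intros t. simpl. ring. }
  rewrite EW. unfold W, kernel.
  transitivity (loop (fun _ => RtoC 1)).
  { apply loop_ext. intros t.
    assert (N := circ_neq r t (RtoC 0)). rewrite Cmod_0 in N. specialize (N (proj1 Hr)).
    assert (N' : circ r t <> RtoC 0). { intros E0. apply N. rewrite E0. ring. }
    replace (circ r t - 0)%C with (circ r t) by ring. simpl. field. auto. }
  rewrite (RInt_const (V := C_R_CompleteNormedModule)), scal_R_Cmult.
  rewrite Rminus_0_r. apply Cmult_1_r.
Qed.

Lemma ccont_fst (T : UniformSpace) (u : T -> C) (x : T) :
  ccont u x -> @continuous T R_UniformSpace (fun y => fst (u y)) x.
Proof.
  intros H. apply (filterlim_locally (fun y => fst (u y)) (fst (u x))). intros eps.
  generalize (proj1 (ccont_iff T u x) H eps (cond_pos eps)). apply filter_imp.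
  intros y Hy. eapply Rle_lt_trans; [|exact Hy].
  eapply Rle_trans; [|apply Rmax_Cmod]. apply Rmax_l.
Qed.

Lemma ccont_snd (T : UniformSpace) (u : T -> C) (x : T) :
  ccont u x -> @continuous T R_UniformSpace (fun y => snd (u y)) x.
Proof.
  intros H. apply (filterlim_locally (fun y => snd (u y)) (snd (u x))). intros eps.
  generalize (proj1 (ccont_iff T u x) H eps (cond_pos eps)). apply filter_imp.
  intros y Hy. eapply Rle_lt_trans; [|exact Hy].
  eapply Rle_trans; [|apply Rmax_Cmod]. apply Rmax_r.
Qed.

(** * Contraction of the circle to a point *)

Section Cauchy.

Variables (F f : C -> C) (r : R) (a : C).
Hypothesis HF : forall z, in_disk z -> hder F z (f z).
Hypothesis Hf : cont_disk f.
Hypothesis Hr : 0 < r < 1.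
Hypothesis Ha : Cmod a < r.

Let Da : in_disk a.
Proof. red; lra. Qed.

Let Dp (t theta : R) : 0 <= t <= 1 -> in_disk (pt a (circ r theta) t).
Proof. intros Ht. apply pt_in_disk; auto. apply circ_in_disk; lra. Qed.

(** Uniform continuity on the compact rectangle [0, 1] x [0, 2 PI], applied to real and imaginary
    parts with eta/2 each. *)
Lemma uniform_osc (eta : R) : 0 < eta -> exists delta, 0 < delta /\
  forall t s theta, 0 <= t <= 1 -> 0 <= s <= 1 -> 0 <= theta <= 2 * PI -> Rabs (s - t) < delta ->
  Cmod (f (pt a (circ r theta) s) - f (pt a (circ r theta) t))%C <= eta.
Proof.
  intros Heta.
  set (g := fun t theta => f (pt a (circ r theta) t)).
  assert (Hg : forall t theta, 0 <= t <= 1 ->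
    @continuous (prod_UniformSpace R_UniformSpace R_UniformSpace) CU
      (fun p => g (fst p) (snd p)) (t, theta)).
  { intros t theta Ht. unfold g.
    apply (ccont_comp _ f); [|now apply Hf, Dp].
    unfold pt. apply ccont_plus; [apply ccont_const|].
    apply ccont_mult.
    - apply ccont_RtoC. apply continuous_fst.
    - apply ccont_minus; [|apply ccont_const].
      apply (@continuous_comp (prod_UniformSpace R_UniformSpace R_UniformSpace) R_UniformSpace CU (fun p : R * R => snd p) (circ r)); [apply continuous_snd|].
      apply ccont_circ. }
  assert (Heta2 : 0 < eta / 2) by lra.
  destruct (uniform_continuity_2d (fun t theta => fst (g t theta)) 0 1 0 (2 * PI)) with (eps := mkposreal _ Heta2)
    as [d1 H1].
  { intros t theta Ht _. apply continuity_2d_pt_filterlim.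
    exact (ccont_fst _ _ _ (Hg t theta Ht)). }
  destruct (uniform_continuity_2d (fun t theta => snd (g t theta)) 0 1 0 (2 * PI)) with (eps := mkposreal _ Heta2)
    as [d2 H2].
  { intros t theta Ht _. apply continuity_2d_pt_filterlim.
    exact (ccont_snd _ _ _ (Hg t theta Ht)). }
  exists (Rmin d1 d2). split; [apply Rmin_pos; apply cond_pos|].
  intros t s theta Ht Hs Hth Hst.
  eapply Rle_trans; [apply Cmod_le_sum|].
  assert (Z : forall d : posreal, Rabs (theta - theta) < d).
  { intros d. rewrite Rminus_diag, Rabs_R0. apply cond_pos. }
  assert (W1 := H1 t theta s theta Ht Hth Hs Hth (Rlt_le_trans _ _ _ Hst (Rmin_l _ _)) (Z d1)).
  assert (W2 := H2 t theta s theta Ht Hth Hs Hth (Rlt_le_trans _ _ _ Hst (Rmin_r _ _)) (Z d2)).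
  unfold g in W1, W2. simpl in W1, W2. simpl. unfold Rminus in *. lra.
Qed.

Lemma rcont_pt_circ (t : R) : rcont (fun theta => pt a (circ r theta) t).
Proof.
  intros theta. unfold pt. apply (ccont_plus R_UniformSpace); [apply (ccont_const R_UniformSpace)|].
  apply (ccont_mult R_UniformSpace); [apply (ccont_const R_UniformSpace)|].
  apply (ccont_minus R_UniformSpace); [apply ccont_circ|apply (ccont_const R_UniformSpace)].
Qed.

Lemma rcont_f_pt (t : R) : 0 <= t <= 1 -> rcont (fun theta => f (pt a (circ r theta) t)).
Proof.
  intros Ht theta. apply (ccont_comp R_UniformSpace f); [apply rcont_pt_circ|]. now apply Hf, Dp.
Qed.

Lemma rcont_F_pt (t : R) : 0 <= t <= 1 -> rcont (fun theta => F (pt a (circ r theta) t)).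
Proof.
  intros Ht theta. apply (ccont_comp R_UniformSpace F); [apply rcont_pt_circ|].
  eapply hder_ccont. now apply HF, Dp.
Qed.

Lemma rcont_circ : rcont (circ r).
Proof. intros t. apply ccont_circ. Qed.

(** This is the formal t-derivative of the homotopy integral. It vanishes because t i zeta f(a + t
    (zeta - a)) is the angular derivative of F(a + t (zeta - a)); dividing by t forces a separate
    case t = 0, where zeta itself integrates to 0. *)
Lemma loop_f_pt_0 (t : R) : 0 <= t <= 1 ->
  loop (fun theta => circ r theta * f (pt a (circ r theta) t))%C = RtoC 0.
Proof.
  intros Ht.
  assert (NCi : Ci <> RtoC 0) by apply Ci_nz.
  destruct (Req_dec t 0) as [->|Hn].
  - assert (Z : loop (fun theta => Ci * circ r theta)%C = RtoC 0).
    { apply loop_derive_0 with (u := circ r).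
      - intros s. apply rder_circ.
      - apply rcont_mult; [apply rcont_const|apply rcont_circ].
      - now rewrite circ_2PI. }
    transitivity (loop (fun theta => f a / Ci * (Ci * circ r theta))%C).
    + apply loop_ext. intros s. replace (pt a (circ r s) 0) with a by (unfold pt; ring).
      field. auto.
    + rewrite loop_scal, Z; [apply Cmult_0_r|]. apply rcont_mult; [apply rcont_const|apply rcont_circ].
  - assert (Nt : RtoC t <> RtoC 0) by (intros E; apply Hn; now apply RtoC_inj).
    assert (Hc : rcont (fun theta => f (pt a (circ r theta) t) * (RtoC t * (Ci * circ r theta)))%C).
    { apply rcont_mult; [now apply rcont_f_pt|]. apply rcont_mult; [apply rcont_const|].
      apply rcont_mult; [apply rcont_const|apply rcont_circ]. }
    assert (Z : loop (fun theta => f (pt a (circ r theta) t) * (RtoC t * (Ci * circ r theta)))%C = RtoC 0).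
    { apply loop_derive_0 with (u := fun theta => F (pt a (circ r theta) t)); auto.
      - intros s. apply hder_rder_comp; [now apply HF, Dp|].
        apply (hder_rder_comp (fun z => pt a z t) (circ r) s (RtoC t)); [|apply rder_circ].
        unfold pt. eapply hder_eq.
        + apply hder_plus; [apply hder_const|]. apply hder_mult; [apply hder_const|].
          apply hder_minus; [apply hder_id|apply hder_const].
        + cbv beta; ring.
      - now rewrite circ_2PI. }
    transitivity (loop (fun theta => / (RtoC t * Ci) * (f (pt a (circ r theta) t) * (RtoC t * (Ci * circ r theta))))%C).
    + apply loop_ext. intros s. field. auto.
    + rewrite loop_scal, Z by auto. apply Cmult_0_r.
Qed.

(** The remainder is the integral of f - f w along the segment, so it is controlled by the
    oscillation of f alone, uniformly in the base point. *)
Lemma first_order (w w' : C) (eta : R) : in_disk w -> in_disk w' ->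
  (forall s, 0 <= s <= 1 -> Cmod (f (pt w w' s) - f w)%C <= eta) ->
  Cmod (F w' - F w - (w' - w) * f w)%C <= eta * Cmod (w' - w)%C.
Proof.
  intros Dw Dw' H.
  assert (Hc : cont_disk (fun _ => f w)) by (intros z _; apply (ccont_const CU)).
  rewrite <- (seg_primitive F f w w') by (auto; intros; apply HF, pt_in_disk; auto).
  replace ((w' - w) * f w)%C with (f w * w' - f w * w)%C by ring.
  rewrite <- (seg_primitive (fun z => f w * z)%C (fun _ => f w) w w'); auto.
  2:{ intros t _. eapply hder_eq. apply hder_mult; [apply hder_const|apply hder_id]. cbv beta; ring. }
  rewrite <- seg_minus by auto.
  apply seg_bound; auto.
  intros z Hz. apply (ccont_minus CU); auto.
Qed.

Let I (t : R) : C := loop (fun theta => F (pt a (circ r theta) t) * (circ r theta * / (circ r theta - a)))%C.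

(** The linear term may be subtracted at no cost since its loop integral is 0. The factor |zeta - a|
    in the first-order remainder cancels the denominator of the kernel. *)
Lemma homotopy_step (eta delta t s : R) : 0 <= eta ->
  (forall t s theta, 0 <= t <= 1 -> 0 <= s <= 1 -> 0 <= theta <= 2 * PI -> Rabs (s - t) < delta ->
    Cmod (f (pt a (circ r theta) s) - f (pt a (circ r theta) t))%C <= eta) ->
  0 <= t <= 1 -> 0 <= s <= 1 -> Rabs (s - t) < delta ->
  Cmod (I s - I t)%C <= 2 * PI * (eta * Rabs (s - t)).
Proof.
  intros Heta Hosc Ht Hs Hst.
  assert (HR := rcont_mult _ _ rcont_circ (rcont_resolvent r a Ha)).
  assert (C1 := rcont_mult _ _ (rcont_F_pt s Hs) HR).
  assert (C2 := rcont_mult _ _ (rcont_F_pt t Ht) HR).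
  assert (C3 := rcont_mult _ _ rcont_circ (rcont_f_pt t Ht)).
  cbv beta in HR, C1, C2, C3.
  assert (C4 := rcont_mult _ _ (rcont_const (RtoC (s - t))) C3). cbv beta in C4.
  replace (I s - I t)%C with (I s - I t - RtoC (s - t) * loop (fun theta => circ r theta * f (pt a (circ r theta) t)))%C
    by (rewrite loop_f_pt_0 by auto; ring).
  unfold I. rewrite <- loop_scal by auto. rewrite <- loop_minus by auto.
  assert (C5 : rcont (fun t0 : R => F (pt a (circ r t0) s) * (circ r t0 * / (circ r t0 - a)) -
         F (pt a (circ r t0) t) * (circ r t0 * / (circ r t0 - a)))%C).
  { intros x. apply (ccont_minus R_UniformSpace); auto. }
  rewrite <- loop_minus by auto.
  apply loop_bound.
  { intros x. apply (ccont_minus R_UniformSpace); auto. }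
  intros x Hx.
  assert (N := circ_neq r x a Ha).
  set (z := circ r x) in *. set (w := pt a z t). set (w' := pt a z s).
  assert (Ew : (w' - w = RtoC (s - t) * (z - a))%C) by (unfold w, w', pt; rewrite RtoC_minus; ring).
  replace (F w' * (z * / (z - a)) - F w * (z * / (z - a)) - RtoC (s - t) * (z * f w))%C
    with ((F w' - F w - (w' - w) * f w) * (z * / (z - a)))%C
    by (rewrite Ew; field; auto).
  rewrite Cmod_mult.
  assert (HO : Cmod (F w' - F w - (w' - w) * f w)%C <= eta * Cmod (w' - w)%C).
  { apply first_order; try (now apply Dp).
    intros u Hu.
    replace (pt w w' u) with (pt a z (t + u * (s - t))).
    2:{ unfold w, w', pt. rewrite RtoC_plus, RtoC_mult, RtoC_minus. ring. }
    apply Hosc; auto.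
    - assert (t + u * (s - t) = (1 - u) * t + u * s) by ring. nra.
    - replace (t + u * (s - t) - t) with (u * (s - t)) by ring.
      rewrite Rabs_mult, (Rabs_pos_eq u) by lra.
      generalize (Rabs_pos (s - t)). nra. }
  assert (P0 : 0 <= Cmod (z * / (z - a))%C) by apply Cmod_ge_0.
  eapply Rle_trans; [apply Rmult_le_compat_r; [exact P0|exact HO]|].
  rewrite Ew, Cmod_mult, Cmod_mult, Cmod_R, Cmod_inv by auto.
  replace (Cmod z) with r by (symmetry; apply Cmod_circ; lra).
  assert (Pz : 0 < Cmod (z - a)%C) by now apply Cmod_gt_0.
  replace (eta * (Rabs (s - t) * Cmod (z - a)) * (r * / Cmod (z - a))) with (eta * Rabs (s - t) * r) by (field; lra).
  assert (0 <= eta * Rabs (s - t)) by (apply Rmult_le_pos; [auto|apply Rabs_pos]).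
  nra.
Qed.

(** [0, 1] is cut into N steps shorter than [delta]; each changes the integral by at most eps/N, so
    the total change is at most eps. *)
Lemma homotopy_const : I 1 = I 0.
Proof.
  assert (HP := PI_RGT_0).
  assert (E : Cmod (I 1 - I 0)%C = 0).
  { apply Rle_antisym; [|apply Cmod_ge_0]. apply le_epsilon. intros eps He. rewrite Rplus_0_l.
    assert (Heta : 0 < eps / (2 * PI)) by (apply Rdiv_lt_0_compat; lra).
    destruct (uniform_osc _ Heta) as [delta [Hd Hosc]].
    destruct (archimed_cor1 delta Hd) as [N [HN HN0]].
    assert (HN1 : 0 < INR N) by now apply lt_0_INR.
    assert (key : forall k, (k <= N)%nat -> Cmod (I (INR k / INR N) - I 0)%C <= INR k / INR N * eps).
    { induction k as [|k IH]; intros Hk.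
      - simpl. replace (0 / INR N) with 0 by (field; lra).
        replace (I 0 - I 0)%C with (RtoC 0) by ring. rewrite Cmod_0. lra.
      - specialize (IH ltac:(lia)).
        assert (Hk' : INR (S k) <= INR N) by now apply le_INR.
        assert (Hk0 : 0 <= INR k) by apply pos_INR. rewrite S_INR in *.
        assert (Ed : (INR k + 1) / INR N - INR k / INR N = / INR N) by (field; lra).
        assert (Hi : 0 < / INR N) by now apply Rinv_0_lt_compat.
        assert (B : forall x, 0 <= x <= INR N -> 0 <= x / INR N <= 1).
        { intros x Hx. split; [apply Rmult_le_pos; lra|].
          apply Rmult_le_reg_r with (INR N); auto. unfold Rdiv. rewrite Rmult_assoc, Rinv_l; lra. }
        assert (ST := homotopy_step (eps / (2 * PI)) delta (INR k / INR N) ((INR k + 1) / INR N)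
           (Rlt_le _ _ Heta) Hosc ltac:(apply B; lra) ltac:(apply B; lra)).
        rewrite Ed, Rabs_pos_eq in ST by lra. specialize (ST HN).
        replace (I ((INR k + 1) / INR N) - I 0)%C with
          ((I ((INR k + 1) / INR N) - I (INR k / INR N)) + (I (INR k / INR N) - I 0))%C by ring.
        eapply Rle_trans; [apply Cmod_triangle|].
        replace ((INR k + 1) / INR N * eps) with (2 * PI * (eps / (2 * PI) * / INR N) + INR k / INR N * eps)
          by (field; lra).
        lra. }
    specialize (key N (Nat.le_refl _)). replace (INR N / INR N) with 1 in key by (field; lra). lra. }
  apply Cmod_eq_0 in E. transitivity (I 1 - I 0 + I 0)%C; [ring|]. rewrite E. ring.
Qed.

(** At t = 1 the homotopy integral is Cauchy's; at t = 0 it is F a times the winding integral. *)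
Lemma cauchy_formula :
  (RtoC (2 * PI) * F a)%C = loop (fun t => F (circ r t) * (circ r t * / (circ r t - a)))%C.
Proof.
  transitivity (I 1).
  - rewrite homotopy_const. unfold I. rewrite <- (loop_winding r a) by auto.
    rewrite Cmult_comm, <- loop_scal.
    + apply loop_ext. intros t. replace (pt a (circ r t) 0) with a by (unfold pt; ring). reflexivity.
    + apply rcont_mult; [apply rcont_circ|]. now apply rcont_resolvent.
  - apply loop_ext. intros t. replace (pt a (circ r t) 1) with (circ r t) by (unfold pt; ring). reflexivity.
Qed.

End Cauchy.

(** * Consequences of Cauchy's formula *)

Lemma hder_unique (f : C -> C) (z l l' : C) : hder f z l -> hder f z l' -> l = l'.
Proof.
  intros H H'. apply is_derive_C_hder in H. apply is_derive_C_hder in H'.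
  rewrite <- (is_C_derive_unique f z l H). now apply is_C_derive_unique.
Qed.

Lemma hder_ext_loc (f g : C -> C) (z l : C) (d : R) : 0 < d ->
  (forall w, Cmod (w - z)%C < d -> f w = g w) -> hder f z l -> hder g z l.
Proof.
  intros Hd H. apply (is_derive_ext_loc (K := C_AbsRing) (V := CV)).
  exists (mkposreal d Hd). intros w Hw. apply H. exact Hw.
Qed.

Lemma hder_ext_disk (f g : C -> C) (z l : C) (r : R) : Cmod z < r ->
  (forall w, Cmod w < r -> f w = g w) -> hder f z l -> hder g z l.
Proof.
  intros Hz H. apply hder_ext_loc with (r - Cmod z); [lra|].
  intros w Hw. apply H. generalize (Cmod_reverse w z). lra.
Qed.

Lemma hder_Cderiv (f : C -> C) (z l : C) : hder f z l -> Cderiv f z = l.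
Proof.
  intros H. eapply hder_unique; [|exact H]. apply is_derive_C_hder.
  unfold Cderiv.
  apply (epsilon_spec (inhabits (RtoC 0)) (fun l : C => is_derive (K := C_AbsRing) (V := C_NormedModule) f z l)).
  exists l. now apply is_derive_C_hder.
Qed.

Lemma hol_hder_Cderiv (f : C -> C) (z : C) : hol f -> in_disk z -> hder f z (Cderiv f z).
Proof. intros Hf Hz. destruct (Hf z Hz) as [l Hl]. now rewrite (hder_Cderiv f z l Hl). Qed.

Lemma twopi_neq : RtoC (2 * PI) <> RtoC 0.
Proof. intros E. apply RtoC_inj in E. generalize PI_RGT_0; lra. Qed.

Lemma rcont_on_circ (F : C -> C) (r : R) : 0 < r < 1 -> cont_disk F -> rcont (fun t => F (circ r t)).
Proof.
  intros Hr HF t. apply (ccont_comp R_UniformSpace F); [apply ccont_circ|].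
  apply HF, circ_in_disk. lra.
Qed.

Lemma hder_scal (c : C) (f : C -> C) (z l : C) : hder f z l -> hder (fun w => c * f w)%C z (c * l)%C.
Proof. intros H. eapply hder_eq. apply hder_mult; [apply hder_const|exact H]. cbv beta; ring. Qed.

(** Near z the primitive F is a kernel of order 1, so f is one of order 2 and f' one of order 3, up
    to constants; a kernel of order 3 is differentiable. *)
Lemma hol_Cderiv (f : C -> C) : hol f -> hol (Cderiv f).
Proof.
  intros Hf z Hz. red in Hz.
  set (F := seg f (RtoC 0)).
  assert (HF : forall w, in_disk w -> hder F w (f w)) by now apply primitive_disk.
  assert (Hc := hol_cont f Hf).
  assert (Hz0 := Cmod_ge_0 z).
  set (r := (1 + Cmod z) / 2). assert (Hr : 0 < r < 1) by (unfold r; lra).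
  assert (Hzr : Cmod z < r) by (unfold r; lra).
  set (phi := fun t => (F (circ r t) * circ r t)%C).
  assert (HcF : cont_disk F) by (intros w Hw; eapply hder_ccont; eauto).
  assert (Hphi : rcont phi).
  { apply rcont_mult; [now apply rcont_on_circ|]. intros t; apply ccont_circ. }
  set (c := (/ RtoC (2 * PI))%C).
  assert (N := twopi_neq).
  assert (E0 : forall a, Cmod a < r -> (c * kernel r phi 1 a)%C = F a).
  { intros a Ha. unfold kernel, phi.
    transitivity (c * (RtoC (2 * PI) * F a))%C.
    - rewrite (cauchy_formula F f r a HF Hc Hr Ha). f_equal. apply loop_ext. intros t. simpl. ring.
    - unfold c. field. auto. }
  assert (E1 : forall a, Cmod a < r -> (c * (RtoC (INR 1) * kernel r phi 2 a))%C = f a).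
  { intros a Ha. apply (hder_unique F a); [|apply HF; red; lra].
    apply (hder_ext_disk _ F a _ r Ha E0).
    apply hder_scal, hder_kernel; auto; lra. }
  assert (E2 : forall a, Cmod a < r -> (c * (RtoC (INR 1) * (RtoC (INR 2) * kernel r phi 3 a)))%C = Cderiv f a).
  { intros a Ha. symmetry. apply hder_Cderiv.
    apply (hder_ext_disk _ f a _ r Ha E1).
    apply hder_scal, hder_scal, hder_kernel; auto; lra. }
  eexists. apply (hder_ext_disk _ (Cderiv f) z _ r Hzr E2).
  apply hder_scal, hder_scal, hder_scal, hder_kernel; auto; lra.
Qed.

(** The derivative of f is now known to be continuous, so f can take the role of the primitive. *)
Lemma cauchy_hol (f : C -> C) (r : R) (a : C) : hol f -> 0 < r < 1 -> Cmod a < r ->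
  (RtoC (2 * PI) * f a)%C = loop (fun t => f (circ r t) * (circ r t * / (circ r t - a)))%C.
Proof.
  intros Hf Hr Ha. apply (cauchy_formula f (Cderiv f)); auto.
  - intros z Hz. now apply hol_hder_Cderiv.
  - now apply hol_cont, hol_Cderiv.
Qed.

(** Removable singularity: zeta / (zeta - a) = 1 + a / (zeta - a), and the term 1 contributes 2 PI
    f(0) = 0. So near 0 the quotient f(a) / a is a kernel, holomorphic at 0 as well. *)
Lemma hol_div_z (f : C -> C) : hol f -> f (RtoC 0) = RtoC 0 ->
  exists g, hol g /\ forall z, in_disk z -> f z = (z * g z)%C.
Proof.
  intros Hf H0. set (r := /2). assert (Hr : 0 < r < 1) by (unfold r; lra).
  assert (Hc := hol_cont f Hf). assert (N := twopi_neq).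
  set (phi := fun t => f (circ r t)).
  assert (Hphi : rcont phi) by now apply rcont_on_circ.
  set (K := fun a => (/ RtoC (2 * PI) * kernel r phi 1 a)%C).
  assert (EK : forall a, Cmod a < r -> f a = (a * K a)%C).
  { intros a Ha.
    assert (Z : Cmod (RtoC 0) < r) by (rewrite Cmod_0; lra).
    assert (L0 : loop phi = RtoC 0).
    { transitivity (RtoC (2 * PI) * f (RtoC 0))%C.
      - rewrite (cauchy_hol f r (RtoC 0)) by auto. apply loop_ext. intros t. unfold phi.
        assert (Nc := circ_neq r t (RtoC 0) Z).
        replace (circ r t - 0)%C with (circ r t) in * by ring. field. auto.
      - rewrite H0. apply Cmult_0_r. }
    assert (HR := rcont_mult _ _ Hphi (rcont_pow _ 1 (rcont_resolvent r a Ha))). cbv beta in HR.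
    assert (E : (a * kernel r phi 1 a)%C = (RtoC (2 * PI) * f a - loop phi)%C).
    { rewrite (cauchy_hol f r a) by auto. unfold kernel. rewrite <- loop_scal by auto.
      rewrite <- loop_minus; auto.
      - apply loop_ext. intros t. unfold phi. assert (Nc := circ_neq r t a Ha). simpl. field. auto.
      - apply rcont_mult; auto. apply rcont_mult; [intros t; apply ccont_circ|]. now apply rcont_resolvent. }
    unfold K. rewrite L0 in E.
    transitivity (/ RtoC (2 * PI) * (a * kernel r phi 1 a))%C; [|ring]. rewrite E. field. auto. }
  exists (fun z => if Ceq_dec z (RtoC 0) then K (RtoC 0) else (f z / z)%C).
  split.
  (* Inside the small circle the glued function is [K]; elsewhere z has a neighbourhood avoiding 0,
     on which it is f / z. *)
  - intros z Hz. destruct (Rlt_dec (Cmod z) r) as [Hzr|Hzr].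
    + eexists. apply (hder_ext_disk K _ z _ r Hzr).
      * intros w Hw. destruct (Ceq_dec w (RtoC 0)) as [->|Nw]; auto.
        rewrite (EK w Hw). field. auto.
      * unfold K. apply hder_scal, hder_kernel; auto; lra.
    + assert (Nz : z <> RtoC 0) by (intros ->; rewrite Cmod_0 in Hzr; lra).
      assert (Hm : 0 < Cmod z) by now apply Cmod_gt_0.
      eexists. apply (hder_ext_loc (fun w => f w * / w)%C _ z _ (Cmod z) Hm).
      * intros w Hw. destruct (Ceq_dec w (RtoC 0)) as [->|Nw]; auto.
        exfalso. replace (0 - z)%C with (- z)%C in Hw by ring. rewrite Cmod_opp in Hw. lra.
      * apply hder_mult; [now apply hol_hder_Cderiv|].
        now apply hder_inv_id.
  - intros z Hz. destruct (Ceq_dec z (RtoC 0)) as [->|Nz].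
    + rewrite H0. ring.
    + field. auto.
Qed.

Lemma hol_mult (f g : C -> C) : hol f -> hol g -> hol (fun z => f z * g z)%C.
Proof.
  intros Hf Hg z Hz. destruct (Hf z Hz) as [a Ha]. destruct (Hg z Hz) as [b Hb].
  eexists. now apply hder_mult; eauto.
Qed.

Lemma hol_plus (f g : C -> C) : hol f -> hol g -> hol (fun z => f z + g z)%C.
Proof.
  intros Hf Hg z Hz. destruct (Hf z Hz) as [a Ha]. destruct (Hg z Hz) as [b Hb].
  eexists. now apply hder_plus; eauto.
Qed.

Lemma hol_const (c : C) : hol (fun _ => c).
Proof. intros z _. eexists. apply hder_const. Qed.

Lemma hol_id : hol (fun z => z).
Proof. intros z _. eexists. apply hder_id. Qed.

Lemma hol_inv (f : C -> C) : hol f -> (forall z, in_disk z -> f z <> RtoC 0) -> hol (fun z => / f z)%C.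
Proof.
  intros Hf Hn z Hz. destruct (Hf z Hz) as [a Ha]. eexists. apply hder_inv; eauto.
Qed.

Lemma hol_pow (f : C -> C) (n : nat) : hol f -> hol (fun z => f z ^ n)%C.
Proof.
  intros Hf. induction n; simpl.
  - apply hol_const.
  - now apply hol_mult.
Qed.

(** * Maximum principle and Schwarz's lemma *)

Lemma pow_bounded_le_1 (x A : R) : (forall n, x ^ n <= A) -> x <= 1.
Proof.
  intros H. apply Rnot_lt_le. intros Hx.
  destruct (Pow_x_infinity x) with (b := A + 1) as [N HN].
  - rewrite Rabs_pos_eq; lra.
  - specialize (HN N (Nat.le_refl _)). rewrite Rabs_pos_eq in HN by (apply pow_le; lra).
    specialize (H N). lra.
Qed.

(* Cauchy's formula for the powers [k ^ n] bounds [|k a| ^ n] by [A * M ^ n] with [A]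
   independent of [n]. *)
Lemma maximum_principle (k : C -> C) (r M : R) (a : C) :
  hol k -> 0 < r < 1 -> Cmod a < r -> 0 < M ->
  (forall t, Cmod (k (circ r t)) <= M) -> Cmod (k a) <= M.
Proof.
  intros Hk Hr Ha HM Hb.
  assert (HP := PI_RGT_0).
  assert (H : Cmod (k a) / M <= 1).
  2:{ apply Rmult_le_reg_r with (/ M); [now apply Rinv_0_lt_compat|]. rewrite Rinv_r by lra. exact H. }
  apply pow_bounded_le_1 with (r * / (r - Cmod a)).
  intros n.
  assert (Hkn := hol_pow k n Hk).
  assert (E := cauchy_hol _ r a Hkn Hr Ha).
  assert (B : Cmod (RtoC (2 * PI) * k a ^ n)%C <= 2 * PI * (M ^ n * (r * / (r - Cmod a)))).
  { rewrite E. apply loop_bound.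
    - apply rcont_mult; [apply (rcont_on_circ (fun z => k z ^ n)%C); auto; now apply hol_cont|].
      apply rcont_mult; [intros t; apply ccont_circ|]. now apply rcont_resolvent.
    - intros t _. assert (N := circ_neq r t a Ha).
      rewrite !Cmod_mult, Cmod_pow, Cmod_inv, Cmod_circ by (auto; lra).
      apply Rmult_le_compat.
      + apply pow_le, Cmod_ge_0.
      + apply Rmult_le_pos; [lra|]. left. apply Rinv_0_lt_compat. now apply Cmod_gt_0.
      + apply pow_incr. split; auto. apply Cmod_ge_0.
      + apply Rmult_le_compat_l; [lra|]. apply Rinv_le_contravar; [lra|]. apply circ_dist. lra. }
  rewrite Cmod_mult, Cmod_R, Rabs_pos_eq, Cmod_pow in B by lra.
  apply Rmult_le_reg_l in B; [|lra].
  unfold Rdiv. rewrite Rpow_mult_distr, pow_inv.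
  assert (0 < M ^ n) by now apply pow_lt.
  apply Rmult_le_reg_r with (M ^ n); auto.
  rewrite Rmult_assoc, Rinv_l by lra. lra.
Qed.

Lemma Cmod_sqr (z : C) : Cmod z * Cmod z = fst z * fst z + snd z * snd z.
Proof. generalize (Cmod2_alt z). unfold Re, Im. simpl. lra. Qed.

(* With [P z = 1 + z * s z] of positive real part, [z * k z = (P z - 1) / (P z + 1)] is a
   Schwarz function, so [|k| <= 1] by the maximum principle. *)
Lemma caratheodory_bound (s : C -> C) (a : C) : hol s ->
  (forall z, in_disk z -> -1 < Re (z * s z)%C) -> in_disk a ->
  Cmod (s a) * (1 - Cmod a) <= 2.
Proof.
  intros Hs HR Ha. red in Ha.
  assert (HN : forall z, in_disk z -> (RtoC 2 + z * s z)%C <> RtoC 0).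
  { intros z Hz E. specialize (HR z Hz).
    assert (E' : Re (RtoC 2 + z * s z)%C = 0) by (rewrite E; reflexivity).
    unfold Re in *. simpl in *. lra. }
  set (k := fun z => (s z * / (RtoC 2 + z * s z))%C).
  assert (Hk : hol k).
  { apply hol_mult; auto. apply hol_inv; auto. apply hol_plus; [apply hol_const|].
    apply hol_mult; auto. apply hol_id. }
  assert (Hkz : forall z, in_disk z -> Cmod z * Cmod (k z) <= 1).
  { intros z Hz. rewrite <- Cmod_mult.
    replace (z * k z)%C with ((z * s z) / (RtoC 2 + z * s z))%C by (unfold k; field; auto).
    rewrite Cmod_div by auto.
    assert (P : 0 < Cmod (2 + z * s z)%C) by now apply Cmod_gt_0, HN.
    apply Rmult_le_reg_r with (Cmod (2 + z * s z)%C); auto.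
    unfold Rdiv. rewrite Rmult_assoc, Rinv_l, Rmult_1_l, Rmult_1_r by lra.
    specialize (HR z Hz). set (w := (z * s z)%C) in *.
    (* |2 + w|^2 - |w|^2 = 4 (1 + Re w), positive by hypothesis. *)
    apply Rsqr_incr_0; try apply Cmod_ge_0. unfold Rsqr. rewrite !Cmod_sqr.
    unfold Re in HR. destruct w as [u v]; simpl in *. nra. }
  assert (H1 : Cmod (k a) <= 1).
  { apply Rnot_lt_le. intros Hgt.
    assert (Ha0 := Cmod_ge_0 a).
    assert (Hi : / Cmod (k a) < 1) by (rewrite <- Rinv_1; apply Rinv_lt_contravar; lra).
    assert (Hi0 : 0 < / Cmod (k a)) by (apply Rinv_0_lt_compat; lra).
    (* A radius r above both |a| and 1/|k a| makes the bound |k a| <= 1/r from the circle absurd. *)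
    set (m := Rmax (Cmod a) (/ Cmod (k a))).
    assert (Hm : m < 1) by now apply Rmax_lub_lt.
    assert (Hm1 : Cmod a <= m) by apply Rmax_l.
    assert (Hm2 : / Cmod (k a) <= m) by apply Rmax_r.
    set (r := (1 + m) / 2).
    assert (Hr : 0 < r < 1) by (unfold r; lra).
    assert (Hrm : m < r) by (unfold r; lra).
    assert (Hri : 0 < / r) by now apply Rinv_0_lt_compat.
    assert (B : Cmod (k a) <= / r).
    { apply (maximum_principle k r (/ r) a); auto; [lra|].
      intros t. specialize (Hkz (circ r t) (circ_in_disk r t ltac:(lra))).
      rewrite Cmod_circ in Hkz by lra.
      apply Rmult_le_reg_l with r; [lra|]. rewrite Rinv_r by lra. exact Hkz. }
    apply (Rmult_le_compat_l r) in B; [|lra]. rewrite Rinv_r in B by lra.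
    assert (Q : Cmod (k a) * / Cmod (k a) = 1) by (apply Rinv_r; lra).
    nra. }
  (* Inverting the Cayley transform: s = 2k / (1 - a k), and |1 - a k| >= 1 - |a|. *)
  assert (E : (s a * (1 - a * k a))%C = (RtoC 2 * k a)%C).
  { unfold k. field. now apply HN. }
  assert (E' : Cmod (s a) * Cmod (1 - a * k a)%C = 2 * Cmod (k a)).
  { rewrite <- Cmod_mult, E, Cmod_mult, Cmod_R, Rabs_pos_eq; lra. }
  assert (T := Cmod_reverse (RtoC 1) (a * k a)%C). rewrite Cmod_1, Cmod_mult in T.
  assert (Ha0 := Cmod_ge_0 a). assert (Hs0 := Cmod_ge_0 (s a)).
  assert (1 - Cmod a <= Cmod (1 - a * k a)%C) by nra.
  nra.
Qed.

(** * The Alexander transform *)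

(** The two integrands can differ only at t = 0, which the integral ignores; for z = 0 both carry
    the factor 0. *)
Lemma seg_alexander (f g : C -> C) (z : C) :
  (forall w, in_disk w -> f w = (w * g w)%C) -> in_disk z ->
  seg g (RtoC 0) z = alexander f z.
Proof.
  intros Hfg Hz. apply (RInt_ext (V := C_R_CompleteNormedModule)).
  intros t Ht. rewrite Rmin_left, Rmax_right in Ht by lra.
  unfold pt. replace (0 + t * (z - 0))%C with (t * z)%C by ring.
  replace (z - 0)%C with z by ring.
  destruct (Ceq_dec z (RtoC 0)) as [->|Nz].
  { now rewrite !Cmult_0_r. }
  assert (Nt : RtoC t <> RtoC 0) by (intros E; apply RtoC_inj in E; lra).
  rewrite Hfg.
  - assert (X : forall x y u : C, y <> RtoC 0 -> u <> RtoC 0 -> (x * y = u * y * x / (u * y) * y)%C).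
    { intros. field. auto. }
    now apply X.
  - red. red in Hz. rewrite Cmod_mult, Cmod_R, Rabs_pos_eq by lra.
    generalize (Cmod_ge_0 z). nra.
Qed.

Lemma alexander_preschwarzian (f g : C -> C) (z : C) :
  hol g -> (forall w, in_disk w -> f w = (w * g w)%C) -> in_disk z ->
  Cdiv (Cderiv (Cderiv (alexander f)) z) (Cderiv (alexander f) z) = (Cderiv g z / g z)%C.
Proof.
  intros Hg Hfg Hz.
  assert (E : forall w, in_disk w -> Cderiv (alexander f) w = g w).
  { intros w Hw. apply hder_Cderiv.
    apply (hder_ext_disk (seg g (RtoC 0)) _ w _ 1 Hw).
    - intros v Hv. now apply seg_alexander.
    - now apply primitive_disk. }
  rewrite (E z Hz). f_equal. apply hder_Cderiv.
  apply (hder_ext_disk g _ z _ 1 Hz).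
  - intros w Hw. symmetry. now apply E.
  - now apply hol_hder_Cderiv.
Qed.

Lemma Sstar_bound (alpha lam : R) (f : C -> C) :
  - (PI / 2) < alpha < PI / 2 -> lam < 1 -> Sstar alpha lam f ->
  Rbar_le (preschwarzian_norm (alexander f)) (Finite (4 * (1 - lam) * cos alpha)).
Proof.
  intros Hal Hlam [[HA [Hf0 Hf1]] [Hnz HRe]].
  assert (Hcos : 0 < cos alpha) by (apply cos_gt_0; lra).
  set (B := (1 - lam) * cos alpha).
  assert (HB : 0 < B) by (apply Rmult_lt_0_compat; lra).
  assert (Hf : hol f).
  { intros z Hz. destruct (HA z Hz) as [l Hl]. exists l. now apply is_derive_C_hder. }
  destruct (hol_div_z f Hf Hf0) as [g [Hg Hfg]].
  assert (D0 : in_disk (RtoC 0)) by (red; rewrite Cmod_0; lra).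
  assert (Hdf : forall z, in_disk z -> Cderiv f z = (g z + z * Cderiv g z)%C).
  { intros z Hz. apply hder_Cderiv.
    apply (hder_ext_disk (fun z => z * g z)%C _ z _ 1 Hz).
    - intros w Hw. symmetry. now apply Hfg.
    - eapply hder_eq. apply hder_mult; [apply hder_id|now apply hol_hder_Cderiv]. cbv beta; ring. }
  (* The normalisation f'(0) = 1 enters here; it makes g nonvanishing at 0, where the condition on f
     says nothing. *)
  assert (Hg0 : g (RtoC 0) = RtoC 1).
  { rewrite <- Hf1, (Hdf _ D0). ring. }
  assert (Hgn : forall z, in_disk z -> g z <> RtoC 0).
  { intros z Hz E. destruct (Ceq_dec z (RtoC 0)) as [->|Nz].
    - rewrite Hg0 in E. now apply C1_nz.
    - apply (Hnz z Hz Nz). rewrite (Hfg z Hz), E. ring. }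
  set (q := fun z => (Cderiv g z * / g z)%C).
  assert (Hq : hol q) by (apply hol_mult; [now apply hol_Cderiv|now apply hol_inv]).
  set (s := fun z => (cexpi alpha * / RtoC B * q z)%C).
  assert (Hs : hol s) by (apply hol_mult; [apply hol_const|auto]).
  assert (NB : RtoC B <> RtoC 0) by (intros E; apply RtoC_inj in E; lra).
  assert (HsR : forall z, in_disk z -> -1 < Re (z * s z)%C).
  { intros z Hz. destruct (Ceq_dec z (RtoC 0)) as [->|Nz].
    - rewrite Cmult_0_l. simpl. lra.
    - specialize (HRe z Hz Nz).
      replace (cexpi alpha * (z * Cderiv f z / f z))%C with (cexpi alpha + RtoC B * (z * s z))%C in HRe.
      + unfold Re in HRe. change (fst (cexpi alpha + RtoC B * (z * s z)))%C
          with (cos alpha + fst (RtoC B * (z * s z))%C) in HRe.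
        change (fst (RtoC B * (z * s z))%C) with (Re (RtoC B * (z * s z))%C) in HRe.
        rewrite re_scal_l in HRe.
        apply Rmult_lt_reg_l with B; auto. unfold B in *. lra.
      + rewrite (Hdf z Hz), (Hfg z Hz). unfold s, q. field. auto. }
  unfold preschwarzian_norm.
  apply (proj2 (Lub_Rbar_correct _)).
  intros x [z [Hz ->]].
  rewrite (alexander_preschwarzian f g z Hg Hfg Hz).
  assert (HC := caratheodory_bound s z Hs HsR Hz).
  assert (Es : Cmod (Cderiv g z / g z)%C = B * Cmod (s z)).
  { unfold s. rewrite !Cmod_mult, Cmod_cexpi, Cmod_inv, Cmod_R, Rabs_pos_eq by (auto; lra).
    unfold q, Cdiv. field. lra. }
  rewrite Es. red in Hz. assert (Hz0 := Cmod_ge_0 z). assert (Hs0 := Cmod_ge_0 (s z)).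
  unfold Rbar_le. replace (4 * (1 - lam) * cos alpha) with (B * 4) by (unfold B; ring).
  (* One factor of 1 - |z|^2 is absorbed by the bound 2 on |s| (1 - |z|), the other is below 2. *)
  replace ((1 - Cmod z ^ 2) * (B * Cmod (s z))) with (B * (Cmod (s z) * (1 - Cmod z) * (1 + Cmod z))) by ring.
  apply Rmult_le_compat_l; [lra|]. nra.
Qed.

(** * The complex exponential *)

Definition cexp (z : C) : C := (RtoC (exp (fst z)) * cexpi (snd z))%C.

Lemma cexp_plus (z w : C) : cexp (z + w)%C = (cexp z * cexp w)%C.
Proof.
  unfold cexp, cexpi, Cmult, Cplus, RtoC. simpl. rewrite exp_plus, cos_plus, sin_plus.
  f_equal; ring.
Qed.

Lemma cexp_0 : cexp (RtoC 0) = RtoC 1.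
Proof. unfold cexp, cexpi; simpl. rewrite exp_0, cos_0, sin_0. unfold Cmult, RtoC; simpl. f_equal; ring. Qed.

Lemma cexp_neq_0 (z : C) : cexp z <> RtoC 0.
Proof.
  intros E. assert (H := cexp_plus z (- z)%C). rewrite E, Cplus_opp_r, cexp_0, Cmult_0_l in H.
  now apply C1_nz.
Qed.

Lemma hder_cexp_0 : hder cexp (RtoC 0) (RtoC 1).
Proof.
  apply hder_iff. intros eps He.
  (* With h = x + i y, n = |h|, E = e^x, P = e^(i y), the error is E (P - 1 - i y) + i y (E - 1) +
     (E - 1 - x). The parts are at most 3 e n, 2 n^2 and e n; since n < e/2, the sum is below 5 e
     n. *)
  set (e := Rmin 1 (eps / 5)).
  assert (He0 : 0 < e) by (apply Rmin_pos; lra).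
  assert (He1 : e <= 1) by apply Rmin_l. assert (He5 : e <= eps / 5) by apply Rmin_r.
  assert (Hx : rder (fun s => RtoC (exp s)) 0 (RtoC 1)).
  { unfold RtoC. apply (rder_pair exp (fun _ => 0)).
    - rewrite <- exp_0. apply is_derive_exp.
    - apply (is_derive_const (V := R_NormedModule)). }
  assert (Hy := rder_cexpi 0).
  rewrite rder_iff in Hx, Hy.
  destruct (Hx e He0) as [d1 [Hd1 H1]]. destruct (Hy e He0) as [d2 [Hd2 H2]].
  exists (Rmin (Rmin d1 d2) (e / 2)). split; [repeat apply Rmin_pos; lra|].
  intros h. replace (h - 0)%C with h by ring. intros Hh.
  assert (A1 := Rlt_le_trans _ _ _ Hh (Rmin_l _ _)).
  assert (A2 := Rlt_le_trans _ _ _ A1 (Rmin_r _ _)).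
  apply Rlt_le_trans with (2 := Rmin_l _ _) in A1.
  assert (A3 := Rlt_le_trans _ _ _ Hh (Rmin_r _ _)).
  rewrite cexp_0.
  assert (Bx : Rabs (fst h) <= Cmod h) by (eapply Rle_trans; [apply Rmax_l|apply Rmax_Cmod]).
  assert (By : Rabs (snd h) <= Cmod h) by (eapply Rle_trans; [apply Rmax_r|apply Rmax_Cmod]).
  specialize (H1 (fst h)). specialize (H2 (snd h)).
  replace (cexpi 0) with (RtoC 1) in H2 by (unfold cexpi; now rewrite cos_0, sin_0).
  rewrite exp_0 in H1. rewrite !Rminus_0_r in H1, H2.
  specialize (H1 ltac:(lra)). specialize (H2 ltac:(lra)).
  unfold cexp. set (E := RtoC (exp (fst h))) in *. set (P := cexpi (snd h)) in *.
  assert (Eh : h = (RtoC (fst h) + Ci * RtoC (snd h))%C).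
  { destruct h as [u v]. unfold RtoC, Ci, Cplus, Cmult; simpl. f_equal; ring. }
  set (x := fst h) in *. set (y := snd h) in *.
  replace (E * P - 1 - h * 1)%C with
    (E * (P - 1 - RtoC y * (Ci * 1)) + Ci * RtoC y * (E - 1) + (E - 1 - RtoC x * 1))%C
    by (rewrite Eh; ring).
  set (n := Cmod h) in *. assert (0 <= n) by apply Cmod_ge_0.
  assert (Rabs x >= 0) by (apply Rle_ge, Rabs_pos). assert (Rabs y >= 0) by (apply Rle_ge, Rabs_pos).
  assert (Q1 : Cmod (E - 1 - RtoC x * 1)%C <= e * n) by nra.
  assert (Q2 : Cmod (P - 1 - RtoC y * (Ci * 1))%C <= e * n) by nra.
  assert (Q3 : Cmod (E - 1)%C <= 2 * n).
  { replace (E - 1)%C with ((E - 1 - RtoC x * 1) + RtoC x)%C by ring.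
    eapply Rle_trans; [apply Cmod_triangle|]. rewrite Cmod_R. nra. }
  assert (Q4 : Cmod E <= 3).
  { replace E with ((E - 1) + 1)%C by ring.
    eapply Rle_trans; [apply Cmod_triangle|]. rewrite Cmod_1. lra. }
  eapply Rle_trans; [apply Cmod_triangle|].
  eapply Rle_trans; [apply Rplus_le_compat_r; apply Cmod_triangle|].
  rewrite !(Cmod_mult E), !(Cmod_mult (Ci * RtoC y)), Cmod_mult, Cmod_Ci, Cmod_R, Rmult_1_l.
  assert (T1 : Cmod E * Cmod (P - 1 - y * (Ci * 1))%C <= 3 * (e * n))
    by (apply Rmult_le_compat; auto; apply Cmod_ge_0).
  assert (T2 : Rabs y * Cmod (E - 1)%C <= n * (2 * n))
    by (apply Rmult_le_compat; auto; [apply Rabs_pos|apply Cmod_ge_0]).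
  nra.
Qed.

(** The addition law carries the derivative at 0 to every point. *)
Lemma hder_cexp (z : C) : hder cexp z (cexp z).
Proof.
  apply (hder_ext_loc (fun w => cexp z * cexp (w - z))%C _ z _ 1 Rlt_0_1).
  - intros w _. rewrite <- cexp_plus. f_equal. ring.
  - eapply hder_eq.
    + apply hder_scal. apply (hder_comp cexp (fun w => w - z)%C).
      * replace (z - z)%C with (RtoC 0) by ring. apply hder_cexp_0.
      * apply hder_minus; [apply hder_id|apply hder_const].
    + ring.
Qed.

(** * The extremal function *)

Lemma one_minus_neq (z : C) : in_disk z -> (RtoC 1 - z)%C <> RtoC 0.
Proof.
  intros Hz. red in Hz. apply Cmod_gt_0. generalize (Cmod_reverse (RtoC 1) z). rewrite Cmod_1. lra.
Qed.

(* [(1 - z) ^ (- c)], with [- log (1 - z)] realised as a primitive of [1 / (1 - z)] *)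
Definition one_minus_pow_opp (c : C) (z : C) : C :=
  (cexp (c * seg (fun w => / (1 - w))%C (RtoC 0) z))%C.

Lemma hder_one_minus_pow_opp (c z : C) : in_disk z ->
  hder (one_minus_pow_opp c) z (one_minus_pow_opp c z * (c / (1 - z)))%C.
Proof.
  intros Hz. unfold one_minus_pow_opp.
  assert (Hh : hol (fun w => / (1 - w))%C).
  { apply (hol_inv (fun w => 1 - w)%C).
    - intros w _. eexists. apply hder_minus; [apply hder_const|apply hder_id].
    - apply one_minus_neq. }
  apply (hder_comp cexp (fun w => c * seg (fun w => / (1 - w)) (RtoC 0) w)%C).
  - apply hder_cexp.
  - unfold Cdiv. apply hder_scal. now apply (primitive_disk _ Hh).
Qed.

Lemma seg_refl (f : C -> C) (a : C) : seg f a a = RtoC 0.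
Proof.
  transitivity (cint (fun _ => RtoC 0) 0 1).
  - apply (RInt_ext (V := C_R_CompleteNormedModule)). intros t _.
    replace (a - a)%C with (RtoC 0) by ring. apply Cmult_0_r.
  - rewrite (RInt_const (V := C_R_CompleteNormedModule)), scal_R_Cmult. apply Cmult_0_r.
Qed.

Lemma one_minus_pow_opp_0 (c : C) : one_minus_pow_opp c (RtoC 0) = RtoC 1.
Proof.
  unfold one_minus_pow_opp. rewrite seg_refl, Cmult_0_r. apply cexp_0.
Qed.

(** 1 + 2z/(1 - z) is the Cayley map (1 + z)/(1 - z), with real part (1 - |z|^2) / |1 - z|^2. *)
Lemma Re_half_plane (z : C) : in_disk z -> -1 < Re (RtoC 2 * z / (1 - z))%C.
Proof.
  intros Hz. assert (N := one_minus_neq z Hz). red in Hz.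
  assert (P : 0 < Cmod (1 - z)%C) by now apply Cmod_gt_0.
  assert (S1 := Cmod_sqr z). assert (S2 := Cmod_sqr (1 - z)%C).
  assert (Hz0 := Cmod_ge_0 z).
  assert (PP : 0 < Cmod (1 - z)%C * Cmod (1 - z)%C) by now apply Rmult_lt_0_compat.
  unfold Re, Cdiv, Cinv. destruct z as [x y]. simpl in *.
  set (D := (1 + - x) * ((1 + - x) * 1) + (0 + - y) * ((0 + - y) * 1)).
  assert (ED : D = (1 + - x) * (1 + - x) + (0 + - y) * (0 + - y)) by (unfold D; ring).
  assert (PD : 0 < D) by (rewrite ED; lra).
  apply Rmult_lt_reg_r with D; auto.
  match goal with |- _ < ?a * D => replace (a * D) with (2 * x * (1 - x) - 2 * y * y) by (field; lra) end.
  rewrite ED. nra.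
Qed.

Lemma Sstar_sharp (alpha lam : R) : - (PI / 2) < alpha < PI / 2 -> lam < 1 ->
  exists f : C -> C, Sstar alpha lam f /\
     preschwarzian_norm (alexander f) = Finite (4 * (1 - lam) * cos alpha).
Proof.
  intros Hal Hlam.
  assert (Hcos : 0 < cos alpha) by (apply cos_gt_0; lra).
  set (B := (1 - lam) * cos alpha).
  assert (HB : 0 < B) by (apply Rmult_lt_0_compat; lra).
  set (c := (RtoC (2 * B) * cexpi (- alpha))%C).
  set (g := one_minus_pow_opp c).
  set (f := fun z => (z * g z)%C).
  assert (Hdg : forall z, in_disk z -> hder g z (g z * (c / (1 - z)))%C) by apply hder_one_minus_pow_opp.
  assert (Hg : hol g) by (intros z Hz; eexists; apply Hdg; auto).
  assert (Hdf : forall z, in_disk z -> hder f z (g z * (1 + z * (c / (1 - z))))%C).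
  { intros z Hz. eapply hder_eq. apply hder_mult; [apply hder_id|now apply Hdg]. cbv beta; ring. }
  assert (Hgn : forall z, g z <> RtoC 0) by (intros z; apply cexp_neq_0).
  assert (D0 : in_disk (RtoC 0)) by (red; rewrite Cmod_0; lra).
  assert (Hei : (cexpi alpha * cexpi (- alpha))%C = RtoC 1).
  { unfold cexpi, Cmult, RtoC; simpl. rewrite cos_neg, sin_neg.
    f_equal; [|ring]. generalize (sin2_cos2 alpha). unfold Rsqr. lra. }
  assert (HS : Sstar alpha lam f).
  { split; [split; [|split]|split].
    - intros z Hz. eexists. apply is_derive_C_hder. now apply Hdf.
    - unfold f. ring.
    - rewrite (hder_Cderiv _ _ _ (Hdf _ D0)). unfold g. rewrite one_minus_pow_opp_0. ring.
    - intros z Hz Nz. unfold f. now apply Cmult_neq_0.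
    - intros z Hz Nz. rewrite (hder_Cderiv _ _ _ (Hdf _ Hz)).
      assert (N1 := one_minus_neq z Hz).
      replace (cexpi alpha * (z * (g z * (1 + z * (c / (1 - z)))) / f z))%C
        with (cexpi alpha + RtoC B * (RtoC 2 * z / (1 - z)))%C.
      + unfold Re. change (fst (cexpi alpha + RtoC B * (RtoC 2 * z / (1 - z))))%C
          with (cos alpha + Re (RtoC B * (RtoC 2 * z / (1 - z)))%C).
        rewrite re_scal_l. assert (HH := Re_half_plane z Hz).
        apply (Rmult_lt_compat_l B) in HH; auto. unfold B in *. lra.
      + transitivity (cexpi alpha + (cexpi alpha * cexpi (- alpha)) * (RtoC B * (RtoC 2 * z / (1 - z))))%C.
        * rewrite Hei. ring.
        * unfold f, c. rewrite RtoC_mult. field. auto. }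
  exists f. split; auto.
  assert (Hub := Sstar_bound alpha lam f Hal Hlam HS).
  replace (4 * (1 - lam) * cos alpha) with (4 * B) in * by (unfold B; ring).
  (* On the positive real axis the weighted quotient is exactly (1 - x^2) 2B / (1 - x) = 2B (1 +
     x). *)
  assert (Hlb : forall x, 0 <= x < 1 -> Rbar_le (Finite (2 * B * (1 + x))) (preschwarzian_norm (alexander f))).
  { intros x Hx. apply (proj1 (Lub_Rbar_correct _)).
    assert (Dx : in_disk (RtoC x)) by (red; rewrite Cmod_R, Rabs_pos_eq; lra).
    exists (RtoC x). split; auto.
    rewrite (alexander_preschwarzian f g _ Hg (fun w _ => eq_refl) Dx).
    rewrite (hder_Cderiv _ _ _ (Hdg _ Dx)).
    assert (N1 := one_minus_neq _ Dx).
    replace (g x * (c / (1 - x)) / g x)%C with (c / (1 - x))%C by (field; auto).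
    rewrite Cmod_div by auto. unfold c. rewrite Cmod_mult, Cmod_cexpi, <- RtoC_minus, !Cmod_R.
    rewrite !Rabs_pos_eq by lra. field. lra. }
  destruct (preschwarzian_norm (alexander f)) as [l| |].
  - simpl in Hub. f_equal. apply Rle_antisym; auto.
    apply Rnot_lt_le. intros Hlt.
    assert (H0 := Hlb 0 ltac:(lra)). simpl in H0.
    (* If l < 4B, the midpoint of l/(2B) - 1 and 1 gives 2B (1 + x) > l. The bound at 0 yields l >=
       2B, so that x is in [0, 1). *)
    set (x := (l / (2 * B) - 1 + 1) / 2).
    assert (El : l = 2 * B * (l / (2 * B))) by (field; lra).
    assert (L1 : 1 <= l / (2 * B)) by nra.
    assert (L2 : l / (2 * B) < 2) by nra.
    assert (H1 := Hlb x ltac:(unfold x; lra)). simpl in H1. unfold x in H1. nra.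
  - destruct Hub.
  - destruct (Hlb 0 ltac:(lra)).
Qed.

Theorem theorem3p2 (alpha lam : R) :
  - (PI / 2) < alpha < PI / 2 -> lam < 1 ->
  (forall f : C -> C, Sstar alpha lam f ->
     Rbar_le (preschwarzian_norm (alexander f)) (Finite (4 * (1 - lam) * cos alpha))) /\
  (exists f : C -> C, Sstar alpha lam f /\
     preschwarzian_norm (alexander f) = Finite (4 * (1 - lam) * cos alpha)).
Proof.
  intros Hal Hlam. split.
  - intros f Hf. now apply Sstar_bound.
  - now apply Sstar_sharp.
Qed.
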